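(* There is an absolute constant $C>0$ such that the following holds. Let $n,N\ge1$ and let $X_1,\ldots,X_N$ be independent random vectors in $\mathbb R^n$ such that $\sup_{i\le N}\sup_{y\in S^{n-1}}\|\langle X_i,y\rangle\|_{\psi_1}\le\psi$ for some $\psi>0$. Then for every $1\le m\le N$, every integer $0\le l\le\log m$, and every $K\ge1$, $$\mathbb P\Big(A_m\ge C\psi K\Big(\frac{m}{2^l}\log\frac{48eN2^l}{m}+\sqrt m\log\frac{2N}{m}\Big)+6\max_{i\le N}|X_i|\Big)\le(1+2l)\exp\Big(-2K\frac{m}{2^l}\log\frac{12eN2^l}{m}\Big).$$ In particular, for every $1\le m\le N$ and every $K\ge1$, $$\mathbb P\Big(A_m\ge C\psi K\sqrt m\log\frac{2N}{m}+6\max_{i\le N}|X_i|\Big)\le(1+2\log m)\exp\Big(-K\sqrt m\log\frac{2N}{m}\Big).$$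
   Context: For a random variable $Y$, $\|Y\|_{\psi_1}=\inf\{C>0:\mathbb E\exp(|Y|/C)\le 2\}$. $A$ is the random $n\times N$ matrix with columns $X_1,\ldots,X_N$, and $A_m=\sup\{|Az|:z\in S^{N-1},|\mathrm{supp}\,z|\le m\}$ (Euclidean norms). $\log$ is the natural logarithm. *)

(* Defs.v *)
(* specialised to Stdlib's concrete reals
   Rdefinitions.R (a realType via Rstruct), so that the absolute constant C
   is a single real number. *)
From HB Require Import structures.
From mathcomp Require Import all_boot all_order all_algebra.
From mathcomp Require Import all_classical all_reals all_analysis.
From mathcomp Require Import Rstruct Rstruct_topology.
Set Implicit Arguments. Unset Strict Implicit. Unset Printing Implicit Defensive.
Import Order.TTheory GRing.Theory Num.Theory.
Local Open Scope classical_set_scope.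
Local Open Scope ring_scope.

Notation RR := Rdefinitions.R.
(* R with its Borel sigma-algebra (generated by intervals). *)
Notation RB := (measurableTypeR Rdefinitions.R).

(* Euclidean inner product and norm on R^n (represented as n.-tuple R, which
   carries the product (= Borel) sigma-algebra). *)
Definition dotp n (x y : n.-tuple RR) : RR := \sum_(j < n) tnth x j * tnth y j.
Definition enorm n (x : n.-tuple RR) : RR := Num.sqrt (dotp x x).

(* psi_1 Orlicz norm: inf { C > 0 : E exp(|Y|/C) <= 2 } (inf of empty = +oo). *)
Definition psi1_norm d (T : measurableType d) (P : probability T RR)
  (Y : T -> RR) : \bar RR :=
  ereal_inf [set c%:E | c in
    [set c : RR | 0 < c /\ (\int[P]_x (expR (`|Y x| / c))%:E <= 2%:E)%E]].

Definition mutually_independent d (T : measurableType d) (P : probability T RR)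
  (N n : nat) (X : 'I_N -> T -> n.-tuple RR) : Prop :=
  forall B : 'I_N -> set (n.-tuple RB), (forall i, measurable (B i)) ->
    P (\bigcap_(i in [set: 'I_N]) (X i @^-1` B i)) =
    (\prod_(i < N) P (X i @^-1` B i))%E.

Definition matA N n (X : 'I_N -> n.-tuple RR) (z : N.-tuple RR) : n.-tuple RR :=
  [tuple \sum_(i < N) tnth z i * tnth (X i) j | j < n].

Definition supp_card N (z : N.-tuple RR) : nat := #|[set i : 'I_N | tnth z i != 0]|.

Definition A_m N n (X : 'I_N -> n.-tuple RR) (m : nat) : \bar RR :=
  ereal_sup [set (enorm (matA X z))%:E | z in
    [set z : N.-tuple RR | enorm z = 1 /\ (supp_card z <= m)%N]].

Definition max_norm N n (X : 'I_N -> n.-tuple RR) : RR :=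
  \big[Num.max/0]_(i < N) enorm (X i).

(* Main.v *)
Require Import Defs.
From HB Require Import structures.
From mathcomp Require Import all_boot all_order all_algebra.
From mathcomp Require Import all_classical all_reals all_analysis.
From mathcomp Require Import Rstruct Rstruct_topology.
From mathcomp Require Import measurable_realfun exp.
From mathcomp Require Import ring lra.
Set Implicit Arguments. Unset Strict Implicit. Unset Printing Implicit Defensive.
Import Order.TTheory GRing.Theory Num.Theory.
Local Open Scope classical_set_scope.
Local Open Scope ring_scope.

(* Let z be a unit vector with at most m nonzero coordinates.  Choosing signs
   greedily gives a partition of the coordinates, z = u + v, such that
   |Az|^2 <= max |X_i|^2 + 4 <Au, Av>.  Cut u and v at dyadic levels: at level k
   at most x = m/2^k coordinates survive, each of size O(x^(-1/2)) except at the
   last level l, where they are only bounded by 1.  Telescoping over the levels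
   reduces <Au, Av> to terms <Aa, Ab> with disjoint supports of size at most x,
   |a|_oo <= al and |b| <= 1, bounded by al * sum_(i in supp a) |<X_i, Ab>|.
   For fixed b, conditionally on Ab, this sum has exponential tails at scale
   psi |Ab|; a union bound over supports and a grid of vectors b costs
   exp(O(x log(N/x))), so with the stated probability the sum is
   O(psi K x log(N/x) |Ab|), and |Ab| <= A_m.  Summing over the levels gives
   A_m^2 <= max |X_i|^2 + O(psi K (...)) A_m, and one solves for A_m. *)

(** * Independence and decoupled tails *)

(** The obstacle is that [A_m] depends on the same vectors as the sums to be bounded, so it cannot
    serve as a threshold in a tail bound. The exceptional events therefore compare the sum over [E]
    with [L * |Ab|], both sides homogeneous in [b], and only for finitely many integer vectors [b].
    Everything after them is a deterministic statement about the Gram matrix of one outcome, where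
    [A_m] enters merely as a number bounding [|Ab|]. Passing from the grid to all [b] needs no
    Lipschitz constant of [A]: the rounding error, doubled, is again an admissible vector.

    With [x_k = m / 2^k] and [y_k = ln (12 e N / x_k)], the threshold [L_k] is of order
    [psi K x_k y_k], to beat the entropy. A level with entries at most [sqrt (2 / x_k)] then costs
    about [sqrt x_k * y_k], which decays geometrically and sums to [O(sqrt m * log (2N/m))]. Only
    the last level, whose entries are bounded by 1, pays the full [x_l y_l]; this is the other term
    of the bound. As [x_k y_k] decreases in [k], the last level also dictates the probability. The
    second inequality comes from choosing [l] so that the two terms balance. *)

Lemma integral_indep_pair d d1 d2 (T : measurableType d)
    (S : measurableType d1) (V : measurableType d2) (R : realType) (P : probability T R)
    (W : T -> S) (Y : T -> V) (h : S * V -> \bar R) :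
  measurable_fun setT W -> measurable_fun setT Y ->
  (forall A B, measurable A -> measurable B ->
     P (W @^-1` A `&` Y @^-1` B) = (P (W @^-1` A) * P (Y @^-1` B))%E) ->
  measurable_fun setT h -> (forall p, 0%E <= h p)%E ->
  (\int[P]_t h (W t, Y t) = \int[P]_t \int[P]_s h (W t, Y s))%E.
Proof.
move=> mW mY ind mh h0.
pose W' : {mfun T >-> S} := HB.pack W (isMeasurableFun.Build _ _ _ _ _ mW).
pose Y' : {mfun T >-> V} := HB.pack Y (isMeasurableFun.Build _ _ _ _ _ mY).
have mWY : measurable_fun setT (fun t => (W t, Y t)) by exact: measurable_fun_pair.
pose Z' : {mfun T >-> (S * V)%type} :=
  HB.pack (fun t => (W t, Y t)) (isMeasurableFun.Build _ _ _ _ _ mWY).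
have E1 : (\int[P]_t h (W t, Y t) = \int[distribution P Z']_p h p)%E.
  by rewrite ge0_integral_distribution.
(* The joint law agrees with the product law on rectangles, hence everywhere; Tonelli then lets the
   first variable be frozen. *)
have E2 : (\int[distribution P Z']_p h p =
           \int[distribution P W' \x distribution P Y']_p h p)%E.
  apply: eq_measure_integral => A mA _; apply/esym.
  apply: (@product_measure_unique _ _ _ _ _ (distribution P W')
    (distribution P Y') (distribution P Z')) => [B C mB mC|].
    by have := ind B C mB mC; rewrite /distribution /pushforward /=.
  exact: mA.
rewrite E1 E2 fubini_tonelli1// ge0_integral_distribution //=; last 2 first.
- exact: measurable_fun_fubini_tonelli_F.
- by move=> y; apply: integral_ge0.
apply: eq_integral => t _ /=; rewrite /fubini_F.
rewrite ge0_integral_distribution //=.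
by apply: measurableT_comp => //; exact: pair1_measurable.
Qed.

(** The tuple sigma-algebra is generated by preimages of single coordinates, a family not stable
    under intersection. Boxes are, as uniqueness of measures requires. *)
Lemma measurable_tuple_rectangles d (T : measurableType d) n :
  (measurable : set (set (n.-tuple T))) =
  <<s [set D | exists B : 'I_n -> set T, (forall i, measurable (B i)) /\
        D = \bigcap_(i in [set: 'I_n]) ((@tnth n _)^~ i @^-1` B i)] >>.
Proof.
apply/seteqP; split.
  apply: smallest_sub; first exact: smallest_sigma_algebra.
  rewrite -bigcup_seq => D [i /= _ [B mB <-]].
  apply: sub_sigma_algebra; exists (fun j => if j == i then B else setT); split.
    by move=> j; case: ifP.
  rewrite setTI; apply/seteqP; split=> [x /= Bx j _ /=|x /= /(_ i Logic.I)].
    by case: eqP => [->|].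
  by rewrite eqxx.
apply: smallest_sub; first exact: sigma_algebra_measurable.
move=> _ [B [mB ->]]; apply: fin_bigcap_measurable => // i _.
by rewrite -[X in measurable X]setTI; exact: measurable_tnth.
Qed.

(** For fixed [C], both sides are finite measures in [A]; they agree on the intersection-stable
    family of boxes and on the whole space, hence on the generated sigma-algebra. *)
Lemma indep_of_indep_coord d d2 d3 (T : measurableType d)
    (S : measurableType d2) (V : measurableType d3)
    (R : realType) (P : probability T R) n (W : T -> n.-tuple S) (Y : T -> V) :
  measurable_fun setT W -> measurable_fun setT Y ->
  (forall (B : 'I_n -> set S) C, (forall i, measurable (B i)) -> measurable C ->
    P (W @^-1` (\bigcap_(i in [set: 'I_n]) ((@tnth n _)^~ i @^-1` B i)) `&` Y @^-1` C) =
    (P (W @^-1` (\bigcap_(i in [set: 'I_n]) ((@tnth n _)^~ i @^-1` B i))) *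
      P (Y @^-1` C))%E) ->
  forall A C, measurable A -> measurable C ->
    P (W @^-1` A `&` Y @^-1` C) = (P (W @^-1` A) * P (Y @^-1` C))%E.
Proof.
move=> mW mY ind A C mA mC.
pose W' : {mfun T >-> n.-tuple S} :=
  HB.pack W (isMeasurableFun.Build _ _ _ _ _ mW).
have mYC : measurable (Y @^-1` C) by rewrite -[X in measurable X]setTI; exact: mY.
have PYC : P (Y @^-1` C) \is a fin_num by exact: fin_num_measure.
have c0 : 0 <= fine (P (Y @^-1` C)) by rewrite fine_ge0.
pose c := NngNum c0.
have := @measure_unique _ _ (n.-tuple S) _ (fun=> setT)
  (measurable_tuple_rectangles S n) _ _ _
  (pushforward (mrestr P mYC) W') (mscale c (pushforward P W')).
move=> H; rewrite muleC -[X in (X * _)%E]fineK //.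
apply: (H _ _ _ mW mW _ _ A mA) => {H}.
- move=> _ _ [B1 [mB1 ->]] [B2 [mB2 ->]].
  exists (fun i => B1 i `&` B2 i); split; first by move=> i; exact: measurableI.
  by rewrite -bigcapI.
- move=> _; exists (fun=> setT); split => //.
  by apply/seteqP; split.
- by rewrite bigcup_const //; exists 0%N.
- move=> _ [B [mB ->]]; apply: (etrans (ind B C mB mC)).
  by rewrite muleC -[X in (X * _)%E]fineK.
- move=> k; change (P (W @^-1` setT `&` Y @^-1` C) < +oo)%E.
  by rewrite preimage_setT setTI ltey_eq PYC.
Qed.

(** * Euclidean norms, normalised vectors and their measurability *)

Lemma measurable_dotp d (S : measurableType d) n (f g : S -> n.-tuple RR) :
  measurable_fun setT (f : S -> n.-tuple RB) ->
  measurable_fun setT (g : S -> n.-tuple RB) ->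
  measurable_fun setT ((fun s => dotp (f s) (g s)) : S -> RB).
Proof.
move=> mf mg; apply: measurable_sum => j.
apply: measurable_funM.
  exact: (measurableT_comp (@measurable_tnth _ RB n j) mf).
exact: (measurableT_comp (@measurable_tnth _ RB n j) mg).
Qed.

Lemma measurable_enorm d (S : measurableType d) n (f : S -> n.-tuple RR) :
  measurable_fun setT (f : S -> n.-tuple RB) ->
  measurable_fun setT ((fun s => enorm (f s)) : S -> RB).
Proof.
move=> mf; apply: (@measurableT_comp _ _ _ _ _ _ (Num.sqrt : RB -> RB)).
  by apply: (@continuous_measurable_fun RR); exact: sqrt_continuous.
exact: measurable_dotp.
Qed.

Lemma measurable_matA d (S : measurableType d) N n
    (f : 'I_N -> S -> n.-tuple RR) (z : N.-tuple RR) :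
  (forall i, measurable_fun setT (f i : S -> n.-tuple RB)) ->
  measurable_fun setT
    ((fun s => matA (fun i => f i s) z) : S -> n.-tuple RB).
Proof.
move=> mf; apply/measurable_fun_tnthP => j.
rewrite (_ : _ \o _ = fun s => \sum_(i < N) tnth z i * tnth (f i s) j); last first.
  by apply/funext => s /=; rewrite tnth_mktuple.
apply: (@measurable_sum _ S RR) => i; apply: measurable_funM => //.
exact: (measurableT_comp (@measurable_tnth _ RB n j) (mf i)).
Qed.

(* When [y = 0] this is [0], since [0^-1 = 0]. *)
Definition unitv n (y : n.-tuple RR) : n.-tuple RR :=
  [tuple (enorm y)^-1 * tnth y j | j < n].

Lemma enorm_ge0 n (y : n.-tuple RR) : 0 <= enorm y.
Proof. exact: sqrtr_ge0. Qed.

Lemma dotp_ge0 n (y : n.-tuple RR) : 0 <= dotp y y.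
Proof. by apply: sumr_ge0 => j _; rewrite -expr2 sqr_ge0. Qed.

Lemma sqr_enorm n (y : n.-tuple RR) : enorm y ^+ 2 = dotp y y.
Proof. by rewrite sqr_sqrtr // dotp_ge0. Qed.

Lemma dotp_unitv n (x y : n.-tuple RR) :
  dotp x (unitv y) = (enorm y)^-1 * dotp x y.
Proof.
rewrite /dotp mulr_sumr; apply: eq_bigr => j _.
by rewrite tnth_mktuple mulrCA.
Qed.

Lemma enorm_unitv n (y : n.-tuple RR) : enorm y != 0 -> enorm (unitv y) = 1.
Proof.
move=> y0; rewrite {1}/enorm dotp_unitv.
have -> : dotp (unitv y) y = dotp y (unitv y).
  by apply: eq_bigr => j _; rewrite mulrC.
by rewrite dotp_unitv -sqr_enorm expr2 mulKf // mulVf // sqrtr1.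
Qed.

Lemma measurable_unitv d (S : measurableType d) n (f : S -> n.-tuple RR) :
  measurable_fun setT (f : S -> n.-tuple RB) ->
  measurable_fun setT ((fun s => unitv (f s)) : S -> n.-tuple RB).
Proof.
move=> mf; apply/measurable_fun_tnthP => j.
rewrite (_ : _ \o _ = fun s => (enorm (f s) `^ (- 1)) * tnth (f s) j); last first.
  by apply/funext => s /=; rewrite tnth_mktuple powR_inv1 // enorm_ge0.
apply: measurable_funM.
  apply: (@measurableT_comp _ _ _ _ _ _ (fun x : RB => (x `^ (-1) : RB))).
    exact: measurable_powR.
  exact: measurable_enorm.
exact: (measurableT_comp (@measurable_tnth _ RB n j) mf).
Qed.

(** Zeroing the [i]-th vector instead of deleting it keeps the index set ['I_N], so [matA] still
    applies; the value of [A z] is unchanged as soon as [z] vanishes at [i]. *)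
Definition drop_coord N n (x : 'I_N -> n.-tuple RR) (i : 'I_N) :
    N.-tuple (n.-tuple RR) :=
  [tuple if j == i then [tuple 0 | _ < n] else x j | j < N].

Section independence.
Context (n N : nat) (d : measure_display) (T : measurableType d)
  (P : probability T RR) (X : 'I_N -> T -> n.-tuple RR).
Hypothesis mX : forall i, measurable_fun [set: T] (X i : T -> n.-tuple RB).
Hypothesis indX : mutually_independent P X.

Let W (i : 'I_N) : T -> N.-tuple (n.-tuple RB) :=
  fun t => drop_coord (fun j => X j t) i.

Let measurable_drop i : measurable_fun setT (W i).
Proof.
apply/measurable_fun_tnthP => j; rewrite /W /drop_coord.
have [->|ji] := eqVneq j i.
  rewrite (_ : _ \o _ = cst [tuple 0 | _ < n]) //.
  by apply/funext => t /=; rewrite tnth_mktuple eqxx.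
rewrite (_ : _ \o _ = X j) //.
by apply/funext => t /=; rewrite tnth_mktuple (negbTE ji).
Qed.

(** It suffices to test boxes. If the [i]-th side misses the zero vector, the preimage is empty;
    otherwise that side imposes nothing and can be replaced by [setT], or by [C] for the joint
    event, and mutual independence applies. *)
Let indep_drop i (A : set (N.-tuple (n.-tuple RB))) (C : set (n.-tuple RB)) :
  measurable A -> measurable C ->
  P (W i @^-1` A `&` X i @^-1` C) = (P (W i @^-1` A) * P (X i @^-1` C))%E.
Proof.
move=> mA mC.
apply: (@indep_of_indep_coord _ _ _ T (n.-tuple RB) (n.-tuple RB) RR P N) => //.
move=> {A C mA mC} B C mB mC.
have [B0|B0] := pselect (B i [tuple 0 | _ < n]); last first.
  rewrite (_ : W i @^-1` _ = set0) ?set0I ?measure0 ?mul0e //.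
  apply/seteqP; split => // t /= /(_ i Logic.I) /=.
  by rewrite tnth_mktuple eqxx.
pose B' D j := if j == i then D else B j.
have mB' D : measurable D -> forall j, measurable (B' D j).
  by move=> mD j; rewrite /B'; case: ifP.
have EB : W i @^-1` (\bigcap_(j in [set: 'I_N]) ((@tnth N _)^~ j @^-1` B j)) =
    \bigcap_(j in [set: 'I_N]) (X j @^-1` B' setT j).
  apply/seteqP; split => t /= H j _.
    by have := H j Logic.I; rewrite /= /B' tnth_mktuple; case: eqP.
  by have := H j Logic.I; rewrite /= /B' tnth_mktuple; case: eqP => [->|].
have EC : W i @^-1` (\bigcap_(j in [set: 'I_N]) ((@tnth N _)^~ j @^-1` B j))
      `&` X i @^-1` C = \bigcap_(j in [set: 'I_N]) (X j @^-1` B' C j).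
  rewrite EB; apply/seteqP; split => t /=.
    move=> [H HC] j _; rewrite /B' /=; case: eqP => [->//|ji].
    by have := H j Logic.I; rewrite /B' /=; case: eqP.
  move=> H; split => [j _|].
    by have := H j Logic.I; rewrite /B' /=; case: eqP.
  by have := H i Logic.I; rewrite /B' /= eqxx.
rewrite EC EB !indX; [|exact: mB'|exact: mB'].
rewrite (bigD1 i) //= [in RHS](bigD1 i) //= /B' eqxx preimage_setT probability_setT.
rewrite mul1e muleC; congr (_ * _)%E.
by apply: eq_bigr => j /negbTE ->.
Qed.

(* The factors indexed by [s] are integrated out one at a time: [z] vanishes on
   [s], so the direction [unitv _] is independent of each of them. *)
Lemma integral_prod_expR_le (c : RR) (z : N.-tuple RR) (s : seq 'I_N) : 0 < c ->
  (forall (i : 'I_N) (y : n.-tuple RR), enorm y = 1 ->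
    (\int[P]_x (expR (`|dotp (X i x) y| / c))%:E <= 2%:E)%E) ->
  uniq s -> (forall i, i \in s -> tnth z i = 0) ->
  (\int[P]_t (\prod_(i <- s)
     expR (`|dotp (X i t) (unitv (matA (fun j => X j t) z))| / c))%:E
   <= (2 ^+ size s)%:E)%E.
Proof.
move=> c0 Xc; elim: s => [_ _|i s IH /= /andP[is_ us] zs].
  under eq_integral do rewrite big_nil.
  by rewrite integral_cst // mul1e [X in (X <= _)%E]probability_setT.
have {}IH := IH us (fun j js => zs j (mem_behead (s := i :: s) js)).
have zi : tnth z i = 0 by apply: zs; rewrite mem_head.
pose u (w : N.-tuple (n.-tuple RR)) := unitv (matA (tnth w) z).
pose G (w : N.-tuple (n.-tuple RR)) :=
  \prod_(k <- s) expR (`|dotp (tnth w k) (u w)| / c).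
pose h (p : N.-tuple (n.-tuple RB) * n.-tuple RB) :=
  (G p.1 * expR (`|dotp p.2 (u p.1)| / c))%:E.
have mu : measurable_fun setT (u : N.-tuple (n.-tuple RB) -> n.-tuple RB).
  apply: measurable_unitv.
  apply: (@measurable_matA _ _ N n (fun i (w : N.-tuple (n.-tuple RB)) => tnth w i)).
  by move=> k; exact: measurable_tnth.
have mexp d' (S : measurableType d') (f g : S -> n.-tuple RR) :
    measurable_fun setT (f : S -> n.-tuple RB) ->
    measurable_fun setT (g : S -> n.-tuple RB) ->
    measurable_fun setT ((fun s => expR (`|dotp (f s) (g s)| / c)) : S -> RB).
  move=> mf mg; apply: (measurableT_comp (@measurable_expR RR)).
  apply: measurable_funM => //.
  by apply: (measurableT_comp (@normr_measurable RR _)); exact: measurable_dotp.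
have mG : measurable_fun setT (G : N.-tuple (n.-tuple RB) -> RB).
  apply: (@measurable_prod _ _ RR) => k _; apply: mexp => //.
  exact: measurable_tnth.
have mh : measurable_fun setT h.
  apply/measurable_EFinP; apply: measurable_funM.
    exact: (measurableT_comp mG).
  by apply: mexp => //; exact: (measurableT_comp mu).
have G0 w : 0 <= G w by apply: prodr_ge0 => k _; exact: expR_ge0.
have h0 p : (0%:E <= h p)%E by rewrite lee_fin mulr_ge0 // expR_ge0.
have uW t : u (W i t) = unitv (matA (fun j => X j t) z).
  congr unitv; apply: eq_from_tnth => j; rewrite !tnth_mktuple.
  apply: eq_bigr => k _; rewrite tnth_mktuple.
  by case: eqP => [->|//]; rewrite zi !mul0r.
have GW t : G (W i t) = \prod_(k <- s)
    expR (`|dotp (X k t) (unitv (matA (fun j => X j t) z))| / c).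
  rewrite /G uW !big_seq; apply: eq_bigr => k ks; rewrite tnth_mktuple.
  by case: eqP ks is_ => [->->|].
have -> : (\int[P]_t (\prod_(k <- i :: s)
     expR (`|dotp (X k t) (unitv (matA (fun j => X j t) z))| / c))%:E =
   \int[P]_t h (W i t, X i t))%E.
  by apply: eq_integral => t _; rewrite /h /= GW uW big_cons mulrC.
rewrite (integral_indep_pair (measurable_drop i) (mX i) (@indep_drop i) mh h0).
apply: (@le_trans _ _ (\int[P]_t (2%:E * (G (W i t))%:E))%E).
  apply: ge0_le_integral => //=.
  - by move=> t _; apply: integral_ge0.
  - have := measurable_fun_fubini_tonelli_F (m2 := distribution P
      (HB.pack (X i) (isMeasurableFun.Build _ _ _ _ _ (mX i)) :
        {mfun T >-> n.-tuple RB})) h mh h0.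
    move=> mF; have := measurableT_comp mF (measurable_drop i).
    apply: eq_measurable_fun => t _ /=; rewrite /fubini_F.
    rewrite ge0_integral_distribution //=.
    by apply: measurableT_comp => //; exact: pair1_measurable.
  - apply: emeasurable_funM => //; apply/measurable_EFinP.
    exact: (measurableT_comp mG).
  - move=> t _; rewrite /h /=.
    under eq_integral do rewrite EFinM.
    rewrite ge0_integralZl_EFin //; last by apply/measurable_EFinP; apply: mexp.
    rewrite [leRHS]muleC; apply: lee_wpmul2l; first by rewrite lee_fin.
    (* For [A z = 0] the direction is the zero vector, outside the hypothesis on unit vectors; the
       integrand is then 1, still within the bound 2. *)
    have [u0|u0] := eqVneq (enorm (matA (tnth (W i t)) z)) 0; last first.
      by apply: Xc; exact: enorm_unitv.
    under eq_integral do rewrite dotp_unitv u0 invr0 mul0r normr0 mul0r expR0.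
    by rewrite integral_cst // mul1e [leLHS]probability_setT lee_fin ler1n.
rewrite ge0_integralZl_EFin //; first last.
- by apply/measurable_EFinP; exact: (measurableT_comp mG).
- by move=> t _; rewrite lee_fin.
rewrite exprS EFinM; apply: lee_wpmul2l; first by rewrite lee_fin.
by under eq_integral do rewrite GW.
Qed.

(** Exponential Markov inequality for the sum normalised by [|Y|]: each of the [#|E|] factors has
    expectation at most 2. A threshold proportional to [|Y|] is what allows the random direction to
    be integrated out. *)
Lemma decoupled_tail (c L : RR) (z : N.-tuple RR) (E : {set 'I_N}) : 0 < c ->
  (forall (i : 'I_N) (y : n.-tuple RR), enorm y = 1 ->
    (\int[P]_x (expR (`|dotp (X i x) y| / c))%:E <= 2%:E)%E) ->
  (forall i, i \in E -> tnth z i = 0) ->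
  let Y t := matA (fun j => X j t) z in
  let A := [set t | L * enorm (Y t) < \sum_(i in E) `|dotp (X i t) (Y t)|] in
  measurable A /\ (P A <= (2 ^+ #|E| * expR (- (L / c)))%:E)%E.
Proof.
move=> c0 Xc zE Y A.
have mY : measurable_fun setT (Y : T -> n.-tuple RB) by exact: measurable_matA.
have mA : measurable A.
  rewrite -[A]setTI; apply: (measurable_fun_ltr (R := RR)) => //.
    by apply: measurable_funM => //; exact: measurable_enorm.
  under eq_fun do rewrite -big_enum.
  apply: (@measurable_sum _ T RR) => i.
  by apply: (measurableT_comp (@normr_measurable RR _)); exact: measurable_dotp.
split => //.
have H := @integral_prod_expR_le c z (enum E) c0 Xc (enum_uniq _).
have {H} := H (fun i iE => zE i (etrans (esym (mem_enum E i)) iE)).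
rewrite -cardE => H.
pose F t := \prod_(i <- enum E) expR (`|dotp (X i t) (unitv (Y t))| / c).
have mF : measurable_fun setT (F : T -> RB).
  apply: (@measurable_prod _ _ RR) => k _.
  apply: (measurableT_comp (@measurable_expR RR)); apply: measurable_funM => //.
  apply: (measurableT_comp (@normr_measurable RR _)); apply: measurable_dotp => //.
  exact: measurable_unitv.
have F0 t : 0 <= F t by apply: prodr_ge0 => k _; exact: expR_ge0.
rewrite -[A]setIT -integral_indic // mulrC EFinM.
apply: (@le_trans _ _ (\int[P]_t ((expR (- (L / c)))%:E * (F t)%:E))%E).
  apply: ge0_le_integral => //.
  - by apply/measurable_EFinP; exact: measurable_indic.
  - by apply: emeasurable_funM => //; apply/measurable_EFinP.
  move=> t _; rewrite indicE -EFinM lee_fin.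
  case: (boolP (t \in A)) => [|_]; last by rewrite mulr_ge0 // expR_ge0.
  rewrite inE => At.
  rewrite /F -expR_sum -expRD -expR0 ler_expR addrC subr_ge0.
  rewrite -mulr_suml ler_pM2r ?invr_gt0 // big_enum /=.
  under eq_bigr do rewrite dotp_unitv normrM.
  rewrite -mulr_sumr; set S := (\sum_(_ in _) _).
  (* The strict inequality defining [A] excludes [Y t = 0], where both sides vanish. *)
  have Y0 : 0 < enorm (Y t).
    rewrite lt_neqAle enorm_ge0 andbT; apply/eqP => Y0.
    move: At; rewrite /A /= -Y0 mulr0 big1 ?ltxx // => i _.
    suff YZ : forall j, tnth (Y t) j = 0.
      by rewrite /dotp big1 ?normr0 // => j _; rewrite YZ mulr0.
    move=> j; have := sqr_enorm (Y t); rewrite -Y0 expr0n /=.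
    move=> /esym/eqP; rewrite /dotp psumr_eq0 => [/allP/(_ j)|k _].
      by rewrite mem_index_enum => /(_ isT); rewrite mulf_eq0 orbb => /eqP.
    by rewrite -expr2 sqr_ge0.
  rewrite ger0_norm ?invr_ge0 ?enorm_ge0 // mulrC ler_pdivlMr //.
  exact: ltW.
rewrite ge0_integralZl_EFin //; last exact/measurable_EFinP.
  by apply: lee_wpmul2l => //; rewrite lee_fin expR_ge0.
by move=> t _; rewrite lee_fin.
Qed.

End independence.
(** * Decoupling and chaining for quadratic forms *)

Section quadratic_form.
Context (R : realType) (N : nat) (g : 'I_N -> 'I_N -> R).

(** For [g] the Gram matrix of the [X_i], [rowsum w i] is [<X_i, Aw>], [bform z w] is [<Az, Aw>],
    and [rowsum_norm E w] is the l1 norm over [E] of the products [<X_i, Aw>]. *)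
Definition rowsum (w : 'I_N -> R) (i : 'I_N) : R := \sum_j w j * g i j.
Definition bform (z w : 'I_N -> R) : R := \sum_i z i * rowsum w i.
Definition rowsum_norm (E : {set 'I_N}) (w : 'I_N -> R) : R :=
  \sum_(i in E) `|rowsum w i|.
Definition suppn (w : 'I_N -> R) : nat := #|[pred i | w i != 0]|.
Definition sqnorm (w : 'I_N -> R) : R := \sum_i w i ^+ 2.
Definition restr (A : {set 'I_N}) (w : 'I_N -> R) : 'I_N -> R :=
  fun i => if i \in A then w i else 0.

Lemma rowsumD v w i : rowsum (fun j => v j + w j) i = rowsum v i + rowsum w i.
Proof. by rewrite -big_split; apply: eq_bigr => j _; rewrite mulrDl. Qed.

Lemma rowsumZ a w i : rowsum (fun j => a * w j) i = a * rowsum w i.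
Proof. by rewrite mulr_sumr; apply: eq_bigr => j _; rewrite mulrA. Qed.

Lemma bformDl u v w : bform (fun i => u i + v i) w = bform u w + bform v w.
Proof. by rewrite -big_split; apply: eq_bigr => i _; rewrite mulrDl. Qed.

Lemma bformDr u v w : bform u (fun i => v i + w i) = bform u v + bform u w.
Proof. by rewrite -big_split; apply: eq_bigr => i _; rewrite rowsumD mulrDr. Qed.

Lemma bformZl a u v : bform (fun i => a * u i) v = a * bform u v.
Proof. by rewrite mulr_sumr; apply: eq_bigr => i _; rewrite mulrA. Qed.

Lemma bformZr a u v : bform u (fun i => a * v i) = a * bform u v.
Proof.
by rewrite mulr_sumr; apply: eq_bigr => i _; rewrite rowsumZ mulrCA.
Qed.

Lemma bform_sym u v : (forall i j, g i j = g j i) -> bform u v = bform v u.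
Proof.
move=> gC; rewrite /bform /rowsum.
under eq_bigr do rewrite mulr_sumr.
under [RHS]eq_bigr do rewrite mulr_sumr.
rewrite exchange_big; apply: eq_bigr => i _; apply: eq_bigr => j _.
by rewrite gC mulrCA.
Qed.

Lemma rowsum_normD E v w :
  rowsum_norm E (fun i => v i + w i) <= rowsum_norm E v + rowsum_norm E w.
Proof.
rewrite -big_split; apply: ler_sum => i _.
by rewrite rowsumD; exact: ler_normD.
Qed.

Lemma rowsum_normZ E a w : 0 <= a ->
  rowsum_norm E (fun i => a * w i) = a * rowsum_norm E w.
Proof.
move=> a0; rewrite mulr_sumr; apply: eq_bigr => i _.
by rewrite rowsumZ normrM ger0_norm.
Qed.

Lemma suppnS v w : (forall i, v i = 0 -> w i = 0) -> (suppn w <= suppn v)%N.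
Proof.
move=> vw; apply: subset_leq_card; apply/fintype.subsetP => i.
by rewrite !inE; apply: contraNneq => /vw ->.
Qed.

Lemma sqnorm_le_suppn w h : (forall i, `|w i| <= h) ->
  sqnorm w <= (suppn w)%:R * h ^+ 2.
Proof.
move=> wh; rewrite /sqnorm (bigID (fun i => w i == 0)) /= big1 ?add0r; last first.
  by move=> i /eqP ->; rewrite expr0n.
rewrite /suppn -sum1_card natr_sum mulr_suml.
rewrite [leRHS](eq_bigl (fun i => w i != 0)) => [|i]; last by rewrite inE.
apply: ler_sum => i _; rewrite mul1r -real_normK ?num_real //.
by rewrite ler_sqr ?nnegrE // (le_trans _ (wh i)).
Qed.

Section net.
Variables (E : {set 'I_N}) (x L a : R).
Hypotheses (x0 : 0 < x) (L0 : 0 <= L) (a0 : 0 <= a).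
(** Both sides are homogeneous, so the grid of mesh [h = 1 / (2 sqrt x)] can be rescaled to
    integers. A grid point [h k] in the unit ball has [\sum k_i <= \sum k_i ^ 2 <= h^-2 = 4 x],
    which explains the constant 4. *)
Hypothesis onnet : forall k : 'I_N -> nat,
  (forall i, i \in E -> k i = 0%N) ->
  (suppn (fun i => (k i)%:R))%:R <= x -> (\sum_i k i)%:R <= 4 * x ->
  rowsum_norm E (fun i => (k i)%:R) <=
    L * Num.sqrt (bform (fun i => (k i)%:R) (fun i => (k i)%:R)).
Hypothesis ball : forall w, sqnorm w <= 1 -> (suppn w)%:R <= x ->
  bform w w <= a ^+ 2.

(* Round [b] down to the grid of mesh [1 / (2 sqrt x)]; twice the remainder is
   again admissible, so the error is halved at each step. *)
Let net_iter s b : (forall i, 0 <= b i) -> (forall i, i \in E -> b i = 0) ->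
  sqnorm b <= 1 -> (suppn b)%:R <= x ->
  rowsum_norm E b <= 2 * L * a + (\sum_i \sum_j `|g i j|) / 2 ^+ s.
Proof.
elim: s b => [|s IH] b b0 bE b1 bx.
  have b_le1 j : b j <= 1.
    rewrite -(@expr_le1 _ 2) //; apply: le_trans b1.
    rewrite /sqnorm (bigD1 j) //= lerDl; apply: sumr_ge0 => i _.
    exact: sqr_ge0.
  rewrite expr0 divr1; apply: (@le_trans _ _ (\sum_i \sum_j `|g i j|)); last first.
    by rewrite lerDr !mulr_ge0.
  rewrite /rowsum_norm [leRHS](bigID (mem E)) /=.
  apply: ler_wpDr; first by apply: sumr_ge0 => i _; apply: sumr_ge0.
  apply: ler_sum => i _; apply: le_trans (ler_norm_sum _ _ _) _.
  apply: ler_sum => j _; rewrite normrM ler_piMl // ger0_norm //.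
(* The largest mesh for which the doubled remainder stays in the unit ball: at most [x] entries of
   size at most [2 h] give [x * (2 h) ^ 2 = 1]. *)
pose h := (2 * Num.sqrt x)^-1.
have sx0 : 0 < Num.sqrt x by rewrite sqrtr_gt0.
have h0 : 0 < h by rewrite invr_gt0 mulr_gt0.
have h2 : h ^+ 2 * (4 * x) = 1.
  have -> : 4 * x = (2 * Num.sqrt x) ^+ 2.
    by rewrite exprMn sqr_sqrtr ?ltW // expr2 -natrM.
  by rewrite -exprMn mulVf ?expr1n // mulf_neq0 ?lt0r_neq0.
pose k j := Num.truncn (b j / h).
pose r j := 2 * (b j - h * (k j)%:R).
have kle j : h * (k j)%:R <= b j.
  by rewrite mulrC -ler_pdivlMr // truncn_le // divr_ge0 // ltW.
have klt j : b j - h * (k j)%:R <= h.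
  have := truncnS_gt (b j / h); rewrite ltr_pdivrMr // -natr1 mulrDl mul1r.
  by rewrite -/(k j) => /ltW; rewrite lerBlDr addrC (mulrC h).
have k0 j : b j = 0 -> k j = 0%N.
  by move=> bj; rewrite /k bj mul0r truncn0.
have kx : (suppn (fun i => (k i)%:R))%:R <= x.
  by apply: le_trans bx; rewrite ler_nat; apply: suppnS => j /k0 ->.
have hk1 : sqnorm (fun i => h * (k i)%:R) <= 1.
  apply: le_trans b1; apply: ler_sum => j _.
  by rewrite ler_sqr ?nnegrE ?b0 // mulr_ge0 // ltW.
have hkx : (suppn (fun i => h * (k i)%:R))%:R <= x.
  by apply: le_trans bx; rewrite ler_nat; apply: suppnS => j /k0 ->; rewrite mulr0.
have ksum : (\sum_i k i)%:R <= 4 * x.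
  rewrite -[leRHS]mul1r -ler_pdivrMr ?mulr_gt0 //.
  apply: le_trans hk1; rewrite natr_sum mulr_suml; apply: ler_sum => j _.
  have -> : (4 * x)^-1 = h ^+ 2.
    have nz : 4 * x != 0 by rewrite lt0r_neq0 // mulr_gt0.
    by rewrite (canRL (mulfK nz) h2) div1r.
  rewrite exprMn.
  rewrite mulrC; apply: ler_wpM2l; first by rewrite sqr_ge0.
  by rewrite -natrX ler_nat; case: (k j) => // p; rewrite expnS expn1 leq_pmulr.
have kE i : i \in E -> k i = 0%N by move=> iE; rewrite k0 // bE.
have H1 : rowsum_norm E (fun i => h * (k i)%:R) <= L * a.
  rewrite (rowsum_normZ _ _ (ltW h0)).
  apply: (le_trans (ler_wpM2l (ltW h0) (onnet kE kx ksum))).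
  rewrite mulrCA; apply: ler_wpM2l => //.
  rewrite -{1}(ger0_norm (ltW h0)) -sqrtr_sqr -sqrtrM ?sqr_ge0 //.
  rewrite expr2 -mulrA -bformZr -bformZl.
  by rewrite -[leRHS](ger0_norm a0) -[leRHS]sqrtr_sqr ler_wsqrtr // ball.
have H2 : rowsum_norm E r <= 2 * L * a + (\sum_i \sum_j `|g i j|) / 2 ^+ s.
  have rx : (suppn r)%:R <= x.
    apply: le_trans bx; rewrite ler_nat; apply: suppnS => j bj.
    by rewrite /r bj k0 // mulr0 subrr mulr0.
  apply: IH => //.
  - by move=> j; rewrite mulr_ge0 // subr_ge0.
  - by move=> j jE; rewrite /r bE // kE // mulr0 subrr mulr0.
  - apply: (@le_trans _ _ ((suppn r)%:R * (2 * h) ^+ 2)).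
      apply: sqnorm_le_suppn => j; rewrite ger0_norm; last first.
        by rewrite mulr_ge0 // subr_ge0.
      by rewrite ler_wpM2l.
    apply: (@le_trans _ _ (x * (2 * h) ^+ 2)).
      by rewrite ler_wpM2r // sqr_ge0.
    have -> : x * (2 * h) ^+ 2 = h ^+ 2 * (4 * x) by ring.
    by rewrite h2.
have -> : b = (fun i => h * (k i)%:R + 2^-1 * r i).
  apply/funext => i; rewrite /r mulrA mulVf ?pnatr_eq0 // mul1r.
  by rewrite addrC subrK.
apply: le_trans (rowsum_normD _ _ _) _; rewrite (@rowsum_normZ E 2^-1 r) ?invr_ge0 //.
(* The bound [2 L a] is the fixed point of [t -> L a + t / 2]: the grid point contributes [L a], the
   remainder half of the inductive bound. *)
rewrite exprS invfM; set B := \sum_i _ in H2 *; set q := (2 ^+ s)^-1 in H2 *.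
by move: H1 H2; lra.
Qed.

Let net_pos b : (forall i, 0 <= b i) -> (forall i, i \in E -> b i = 0) ->
  sqnorm b <= 1 -> (suppn b)%:R <= x -> rowsum_norm E b <= 2 * L * a.
Proof.
move=> b0 bE b1 bx; apply/ler_addgt0Pr => e e0.
set B := \sum_i \sum_j `|g i j|.
have B0 : 0 <= B by apply: sumr_ge0 => i _; apply: sumr_ge0.
pose s := Num.truncn (B / e).
apply: le_trans (net_iter s b0 bE b1 bx) _; rewrite lerD2l -/B.
rewrite ler_pdivrMr ?exprn_gt0 // mulrC -ler_pdivrMr //.
apply: ltW; apply: lt_le_trans (truncnS_gt _) _; rewrite -/s.
by rewrite -natrX ler_nat; exact: ltn_expl.
Qed.

(** Rounding down needs nonnegative entries, so positive and negative parts are treated separately;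
    this doubles the constant. *)
Lemma rowsum_norm_le_net b : (forall i, i \in E -> b i = 0) ->
  sqnorm b <= 1 -> (suppn b)%:R <= x -> rowsum_norm E b <= 4 * L * a.
Proof.
move=> bE b1 bx.
have H (c : 'I_N -> R) : (forall i, 0 <= c i) -> (forall i, c i <= `|b i|) ->
    rowsum_norm E c <= 2 * L * a.
  move=> c0 cb; apply: net_pos => //.
  - by move=> i iE; apply/eqP; rewrite eq_le c0 (le_trans (cb i)) // bE // normr0.
  - apply: le_trans b1; apply: ler_sum => i _.
    by rewrite -[leRHS]real_normK ?num_real // ler_sqr ?nnegrE.
  - apply: le_trans bx; rewrite ler_nat; apply: suppnS => i bi.
    by apply/eqP; rewrite eq_le c0 (le_trans (cb i)) // bi normr0.
have -> : b = (fun i => Num.max (b i) 0 + (-1) * Num.max (- b i) 0).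
  apply/funext => i; rewrite mulN1r.
  by case: (lerP (b i) 0) => bi; case: (lerP (- b i) 0) => bi'; lra.
apply: le_trans (rowsum_normD _ _ _) _.
have -> : rowsum_norm E (fun i => -1 * Num.max (- b i) 0) =
    rowsum_norm E (fun i => Num.max (- b i) 0).
  by apply: eq_bigr => i _; rewrite rowsumZ mulN1r normrN.
have Hp : rowsum_norm E (fun i => Num.max (b i) 0) <= 2 * L * a.
  apply: H => i; first by rewrite le_max lexx orbT.
  by rewrite ge_max normr_ge0 ler_norm.
have Hn : rowsum_norm E (fun i => Num.max (- b i) 0) <= 2 * L * a.
  apply: H => i; first by rewrite le_max lexx orbT.
  by rewrite ge_max normr_ge0 -normrN ler_norm.
by apply: le_trans (lerD Hp Hn) _; lra.
Qed.

Lemma bform_le_net u v al : 0 <= al -> (forall i, i \notin E -> u i = 0) ->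
  (forall i, `|u i| <= al) -> (forall i, i \in E -> v i = 0) ->
  sqnorm v <= 1 -> (suppn v)%:R <= x -> `|bform u v| <= 4 * al * L * a.
Proof.
move=> al0 uE ua vE v1 vx.
rewrite /bform (bigID (mem E)) /= [X in _ + X]big1 ?addr0; last first.
  by move=> i iE; rewrite uE // mul0r.
apply: le_trans (ler_norm_sum _ _ _) _.
apply: (@le_trans _ _ (al * rowsum_norm E v)).
  rewrite mulr_sumr; apply: ler_sum => i _.
  by rewrite normrM ler_wpM2r.
rewrite [4 * al]mulrC -!mulrA ler_wpM2l //.
by rewrite mulrA; exact: rowsum_norm_le_net.
Qed.

End net.

(* Signs chosen one at a time: of [s + x] and [s - x], one has
   square norm at most [|s|^2 + |x|^2]. *)
Lemma exists_signs (z : 'I_N -> R) : (forall i j, g i j = g j i) ->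
  exists E : {set 'I_N},
    bform (fun i => (-1) ^+ (i \in E) * z i) (fun i => (-1) ^+ (i \in E) * z i)
      <= \sum_i z i ^+ 2 * g i i.
Proof.
move=> gC.
pose w (e : 'I_N -> bool) i := (-1) ^+ e i * z i.
suff [e He] : exists e : 'I_N -> bool,
    \sum_(i <- enum 'I_N) w e i * \sum_(j <- enum 'I_N) w e j * g i j <=
    \sum_(i <- enum 'I_N) z i ^+ 2 * g i i.
  exists (finset e); move: He; rewrite !big_enum; congr (_ <= _).
  apply: eq_bigr => i _; rewrite /w inE; congr (_ * _); rewrite big_enum.
  by apply: eq_bigr => j _; rewrite inE.
elim: (enum 'I_N) (enum_uniq 'I_N) => [_|i s IH /= /andP[is_ us]].
  by exists (fun=> false); rewrite !big_nil.
have [e He] := IH us.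
pose c := z i * \sum_(j <- s) w e j * g i j.
(* The new sign opposes the cross term [c], which by symmetry of [g] occurs twice, each time as
   [- |c|]. *)
pose e' j := if j == i then 0 < c else e j.
have we' j : j \in s -> w e' j = w e j.
  by move=> js; rewrite /w /e'; case: eqP js is_ => [->->|].
exists e'; rewrite !big_cons.
have -> : \sum_(j <- s) w e' j * g i j = \sum_(j <- s) w e j * g i j.
  by rewrite !big_seq; apply: eq_bigr => j js; rewrite we'.
have -> : \sum_(k <- s) w e' k * (\sum_(j <- i :: s) w e' j * g k j) =
    w e' i * (\sum_(j <- s) w e j * g i j) +
    \sum_(k <- s) w e k * (\sum_(j <- s) w e j * g k j).
  rewrite mulr_sumr -big_split !big_seq; apply: eq_bigr => k ks.
  rewrite we' // big_cons mulrDr; congr (_ + _); first by rewrite gC; ring.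
  by congr (_ * _); rewrite !big_seq; apply: eq_bigr => j js; rewrite we'.
have c0 : w e' i * (\sum_(j <- s) w e j * g i j) = - `|c|.
  rewrite /w /e' eqxx -mulrA -/c; case: (ltP 0 c) => c0 /=.
    by rewrite expr1 mulN1r ger0_norm // ltW.
  by rewrite expr0 mul1r ler0_norm // opprK.
have ww : w e' i * (w e' i * g i i) = z i ^+ 2 * g i i.
  by rewrite mulrA -expr2 /w exprMn sqrr_sign mul1r.
rewrite mulrDr ww c0 -addrA lerD2l addrA.
by apply: le_trans He; rewrite gerDr; have := normr_ge0 c; lra.
Qed.

End quadratic_form.

(** * Chaining over dyadic levels *)

Section chaining.
Context (R : realType) (N : nat) (g : 'I_N -> 'I_N -> R).
Hypothesis gC : forall i j, g i j = g j i.

Lemma sqnorm_restr (A : {set 'I_N}) (u : 'I_N -> R) : sqnorm (restr A u) <= sqnorm u.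
Proof.
apply: ler_sum => i _; rewrite /restr; case: ifP => // _.
by rewrite expr0n sqr_ge0.
Qed.

Lemma suppn_restrS (A B : {set 'I_N}) (u : 'I_N -> R) :
  A \subset B -> (suppn (restr A u) <= suppn (restr B u))%N.
Proof.
move=> /fintype.subsetP AB; apply: suppnS => i; rewrite /restr.
by case: (boolP (i \in A)) => [/AB ->|].
Qed.

(** Write [u_k], [v_k] for the restrictions to [T k]. Then [<u_k, v_k>] is [<u_k - u_{k+1}, v_k> +
    <u_{k+1}, v_k - v_{k+1}> + <u_{k+1}, v_{k+1}>]. In each of the first two terms one argument
    lives on [T k] minus [T k.+1] and is bounded by [al k]; symmetry of [g] moves it to the first
    slot. Each level thus costs [2 * c k]. *)
Lemma bform_chain (u v : 'I_N -> R) (T : nat -> {set 'I_N}) (l : nat)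
    (x al c : nat -> R) :
  T 0%N = [set: 'I_N]%SET -> (forall k, T k.+1 \subset T k) ->
  (forall i, u i = 0 \/ v i = 0) -> sqnorm u <= 1 -> sqnorm v <= 1 ->
  (forall k, (k <= l)%N -> (suppn (restr (T k) u))%:R <= x k) ->
  (forall k, (k <= l)%N -> (suppn (restr (T k) v))%:R <= x k) ->
  (forall k i, (k < l)%N -> i \in T k -> i \notin T k.+1 ->
     `|u i| <= al k /\ `|v i| <= al k) ->
  (forall i, `|u i| <= al l) -> (forall k, 0 <= al k) ->
  (forall k (u' v' : 'I_N -> R), (k <= l)%N ->
     (suppn u')%:R <= x k -> (suppn v')%:R <= x k ->
     (forall i, u' i = 0 \/ v' i = 0) -> (forall i, `|u' i| <= al k) ->
     sqnorm v' <= 1 -> `|bform g u' v'| <= c k) ->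
  `|bform g u v| <= 2 * \sum_(k < l.+1) c k.
Proof.
move=> T0 TS uv u1 v1 ux vx bd bdl al0 H.
have uvr A B i : restr A u i = 0 \/ restr B v i = 0.
  by rewrite /restr; case: ifP; case: ifP => _ _; have := uv i; tauto.
have vur A B i : restr A v i = 0 \/ restr B u i = 0.
  by have := uvr B A i; tauto.
have sx k (w : 'I_N -> R) : (k < l)%N -> (suppn (restr (T k) w))%:R <= x k ->
    (suppn (restr (T k :\: T k.+1) w))%:R <= x k.
  by move=> _ h; apply: le_trans h; rewrite ler_nat; apply: suppn_restrS; exact: subsetDl.
have sx' k (w : 'I_N -> R) : (suppn (restr (T k) w))%:R <= x k ->
    (suppn (restr (T k.+1) w))%:R <= x k.
  by move=> h; apply: le_trans h; rewrite ler_nat; exact: suppn_restrS.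
have split k (w : 'I_N -> R) : restr (T k) w =
    (fun i => restr (T k :\: T k.+1) w i + restr (T k.+1) w i).
  apply/funext => i; rewrite /restr !inE.
  case: (boolP (i \in T k.+1)) => iT /=; last by rewrite addr0.
  by rewrite (fintype.subsetP (TS k)) // add0r.
have iter k : (k <= l)%N -> `|bform g u v| <=
    2 * \sum_(j < k) c j + `|bform g (restr (T k) u) (restr (T k) v)|.
  elim: k => [_|k IH kl].
    rewrite big_ord0 mulr0 add0r T0.
    have rT (w : 'I_N -> R) : restr [set: 'I_N]%SET w = w.
      by apply/funext => i; rewrite /restr inE.
    by rewrite !rT.
  apply: le_trans (IH (ltnW kl)) _.
  rewrite big_ord_recr /= mulrDr -addrA lerD2l.
  rewrite {1}(split k u) bformDl {2}(split k v) bformDr addrA.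
  apply: le_trans (ler_normD _ _) _; rewrite lerD2r.
  apply: le_trans (ler_normD _ _) _; rewrite mulr_natl mulr2n; apply: lerD.
    apply: H => //; first exact: ltnW.
    - by apply: sx => //; apply: ux; exact: ltnW.
    - by apply: vx; exact: ltnW.
    - move=> i; rewrite /restr !inE; case: ifP; last by rewrite normr0.
      by move=> /andP[i1 i2]; have [] := bd k i kl i2 i1.
    - exact: le_trans (sqnorm_restr _ _) v1.
  rewrite bform_sym //; apply: H => //; first exact: ltnW.
  - by apply: sx => //; apply: vx; exact: ltnW.
  - by apply: sx'; apply: ux; exact: ltnW.
  - move=> i; rewrite /restr !inE; case: ifP; last by rewrite normr0.
    by move=> /andP[i1 i2]; have [] := bd k i kl i2 i1.
  - exact: le_trans (sqnorm_restr _ _) u1.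
apply: le_trans (iter l (leqnn l)) _.
rewrite big_ord_recr /= mulrDr lerD2l.
have Hl : `|bform g (restr (T l) u) (restr (T l) v)| <= c l.
  apply: H => //; [exact: ux|exact: vx| |exact: le_trans (sqnorm_restr _ _) v1].
  by move=> i; rewrite /restr; case: ifP; rewrite ?normr0.
by have := le_trans (normr_ge0 _) Hl; lra.
Qed.

(* [z] is cut at the thresholds [z_i ^+ 2 = 2 ^+ k / m], so that at level [k]
   at most [m / 2 ^+ k] coordinates survive. *)
Lemma bform_diag_le (z : 'I_N -> R) (m l : nat) (M : R) (c : nat -> R) :
  let x k := m%:R / 2 ^+ k in
  let al k := if (k < l)%N then Num.sqrt (2 / x k) else 1 in
  (0 < m)%N -> sqnorm z = 1 -> (suppn z <= m)%N -> (forall i, g i i <= M) ->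
  (forall k (u v : 'I_N -> R), (k <= l)%N ->
     (suppn u)%:R <= x k -> (suppn v)%:R <= x k ->
     (forall i, u i = 0 \/ v i = 0) -> (forall i, `|u i| <= al k) ->
     sqnorm v <= 1 -> `|bform g u v| <= c k) ->
  bform g z z <= M + 8 * \sum_(k < l.+1) c k.
Proof.
move=> x al m0 z1 zm gM H.
have [E HE] := exists_signs z gC.
pose u := restr E z; pose v := restr (~: E)%SET z.
have zE : z = (fun i => u i + v i).
  apply/funext => i; rewrite /u /v /restr inE.
  by case: (i \in E); rewrite /= ?addr0 ?add0r.
have zE' : (fun i => (-1) ^+ (i \in E) * z i) = (fun i => v i + (-1) * u i).
  apply/funext => i; rewrite /u /v /restr inE.
  by case: (i \in E); rewrite /= ?expr1 ?expr0 ?mulr0 ?addr0 ?add0r ?mul1r.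
(* The identity [|u + v|^2 = |v - u|^2 + 4 <u, v>]: the signed vector is [v - u], whose form the
   choice of signs keeps below the diagonal sum. With the factor 2 of the chaining this gives 8. *)
have expand : bform g z z =
    bform g (fun i => (-1) ^+ (i \in E) * z i) (fun i => (-1) ^+ (i \in E) * z i)
    + 4 * bform g u v.
  rewrite zE' zE !(bformDl, bformDr, bformZl, bformZr) (bform_sym v u) //.
  by ring.
rewrite expand; apply: lerD.
  apply: le_trans HE _.
  apply: (@le_trans _ _ (sqnorm z * M)); last by rewrite z1 mul1r.
  rewrite mulr_suml; apply: ler_sum => i _.
  by apply: ler_wpM2l; first exact: sqr_ge0.
suff : `|bform g u v| <= 2 * \sum_(k < l.+1) c k.
  by move=> /(le_trans (ler_norm _)); lra.
have m0' : 0 < m%:R :> R by rewrite ltr0n.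
have p2 k : 0 < 2 ^+ k :> R by rewrite exprn_gt0.
(* Level 0 is the whole index set: its support is already bounded by [m], and the small coordinates
   must be kept. A coordinate leaving at level 1 has square at most [2 / m = 2 / x 0]. *)
pose T k : {set 'I_N} :=
  if k is 0%N then [set: 'I_N]%SET else finset (fun i => 2 ^+ k / m%:R < z i ^+ 2).
have z1' i : `|z i| <= 1.
  rewrite -(@expr_le1 _ 2) // real_normK ?num_real // -z1.
  rewrite /sqnorm (bigD1 i) //= lerDl; apply: sumr_ge0 => j _.
  exact: sqr_ge0.
have Tx k A : (suppn (restr (T k) (restr A z)))%:R <= x k.
  case: k => [|k].
    rewrite /x expr0 divr1 ler_nat; apply: leq_trans zm; apply: suppnS => i.
    by rewrite /restr => ->; rewrite !if_same.
  apply: (@le_trans _ _ #|T k.+1|%:R).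
    rewrite ler_nat; apply: subset_leq_card; apply/fintype.subsetP => i.
    by rewrite inE /restr; case: ifP => //; rewrite eqxx.
  (* Markov's inequality: every index of [T k.+1] takes more than [2 ^+ k.+1 / m] of the total mass
     1. *)
  rewrite /x ler_pdivlMr // -[leRHS]mul1r -ler_pdivrMr // -mulrA mulr_natl.
  rewrite -sumr_const -[leRHS]z1.
  rewrite /sqnorm [leRHS](bigID (mem (T k.+1))) /=.
  apply: ler_wpDr; first by apply: sumr_ge0 => i _; exact: sqr_ge0.
  by apply: ler_sum => i; rewrite inE => /ltW.
apply: (@bform_chain u v T l x al c) => //.
- move=> [|k] /=; apply/fintype.subsetP => i; rewrite !inE // => /(le_lt_trans _); apply.
  rewrite ler_pM2r ?invr_gt0 // [leRHS]exprS ler_peMl ?ltW //.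
  by rewrite ltr1n.
- move=> i; rewrite /u /v /restr inE; case: (i \in E) => /=; tauto.
- by rewrite -z1; exact: sqnorm_restr.
- by rewrite -z1; exact: sqnorm_restr.
- by move=> k _; exact: Tx.
- by move=> k _; exact: Tx.
- move=> k i kl _; rewrite !inE -leNgt /al kl => zi.
  have zal : `|z i| <= Num.sqrt (2 / x k).
    rewrite -sqrtr_sqr ler_wsqrtr //; apply: le_trans zi _.
    by rewrite /x invf_div mulrA -exprS.
  by split; rewrite /u /v /restr; case: ifP => // _; rewrite normr0 sqrtr_ge0.
- move=> i; rewrite /al ltnn /u /restr; case: ifP => // _.
  by rewrite normr0 ler01.
- by move=> k; rewrite /al; case: ifP => // _; rewrite ?sqrtr_ge0 ?ler01.
Qed.

End chaining.
(** * Union bound and counting *)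

Lemma finite_union_bound d (T : measurableType d) (R : realType)
    (P : probability T R) (I : finType) (p : pred I) (A : I -> set T) (b : I -> R) :
  (forall i, p i -> measurable (A i) /\ (P (A i) <= (b i)%:E)%E) ->
  exists U, [/\ measurable U, (forall i, p i -> A i `<=` U) &
    (P U <= (\sum_(i | p i) b i)%:E)%E].
Proof.
move=> H; exists (\big[setU/set0]_(i | p i) A i).
have [mU PU] : measurable (\big[setU/set0]_(i | p i) A i) /\
    (P (\big[setU/set0]_(i | p i) A i) <= (\sum_(i | p i) b i)%:E)%E.
  apply: (big_ind2 (fun U r => measurable U /\ (P U <= r%:E)%E)) => //.
    by rewrite measure0.
  move=> U1 r1 U2 r2 [mU1 H1] [mU2 H2]; split; first exact: measurableU.
  rewrite EFinD; apply: (le_trans (measureU2 P mU1 mU2)).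
  exact: leeD.
by split => // i pi; rewrite (bigD1 i) //=; exact: subsetUl.
Qed.

Section counting.
Context (R : realType) (N : nat) (x : R).
Hypotheses (x0 : 0 < x) (xN : x <= N%:R).

Let N0 : 0 < N%:R :> R.
Proof. exact: lt_le_trans xN. Qed.

(* Exponential weights replace binomial estimates: indices of size at most [y]
   have weight at least [1] after tilting. *)
Let expr_weight (q y : R) (s : nat) : 0 < q <= 1 -> s%:R <= y ->
  1 <= q ^+ s * expR (- y * ln q).
Proof.
move=> /andP[q0 q1] sy.
have -> : q ^+ s = expR (s%:R * ln q) by rewrite expRM_natl lnK.
rewrite -expRD -[leLHS]expR0 ler_expR -mulrDl.
by rewrite mulr_le0 ?ln_le0 // subr_le0.
Qed.

(** Tilting with [q = x / N]: the sum of [(2 q) ^+ #|E|] over all sets is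
    [(1 + 2 q) ^+ N <= expR (2 x)], and undoing the tilt costs [q] to the power [- x]. The weight
    [2 ^+ #|E|] is the one produced by [decoupled_tail]. *)
Lemma sum_pow2_card_le :
  \sum_(E : {set 'I_N} | (#|E|%:R <= x)%R) 2 ^+ #|E| <=
    expR (2 * x + x * ln (N%:R / x)).
Proof.
pose q := x / N%:R.
have q01 : 0 < q <= 1 by rewrite divr_gt0 // ler_pdivrMr // mul1r.
have q0 : 0 <= q by case/andP: q01 => /ltW.
have lq : - x * ln q = x * ln (N%:R / x).
  by rewrite /q -[N%:R / x]invf_div lnV ?posrE ?divr_gt0 // mulrN mulNr.
apply: (@le_trans _ _ (\sum_(E : {set 'I_N}) (2 * q) ^+ #|E| * expR (- x * ln q))).
  rewrite [leRHS](bigID (fun E : {set 'I_N} => #|E|%:R <= x)) /=.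
  apply: ler_wpDr.
    by apply: sumr_ge0 => E _; rewrite mulr_ge0 ?expR_ge0 // exprn_ge0 // mulr_ge0.
  apply: ler_sum => E Ex; rewrite exprMn -mulrA ler_peMr ?exprn_ge0 //.
  exact: expr_weight.
rewrite -mulr_suml lq expRD ler_wpM2r ?expR_ge0 //.
have -> : \sum_(E : {set 'I_N}) (2 * q) ^+ #|E| = (2 * q + 1) ^+ N.
  rewrite -[in RHS](card_ord N) -prodr_const bigA_distr.
  apply: eq_bigr => E _; rewrite [RHS](bigID (mem E)) /=.
  rewrite [X in _ = _ * X]big1 ?mulr1 => [|i /negbTE ->//].
  by rewrite -prodr_const; apply: eq_bigr => i ->.
have -> : 2 * x = N%:R * (2 * q).
  by rewrite /q (mulrCA _ 2) (mulrCA _ x) divff ?mulr1 // lt0r_neq0.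
rewrite expRM_natl; apply: lerXn2r; rewrite ?nnegrE ?expR_ge0 //.
  by rewrite addr_ge0 // mulr_ge0.
by rewrite addrC expR_ge1Dx.
Qed.

(** Tilting with [q = x / (2 N) <= 1 / 2], so that each coordinate contributes a geometric sum of at
    most [1 + 2 q], and the product over [N] coordinates is at most [expR x]. The truncation [B]
    only makes the index type finite; the bound does not depend on it. *)
Lemma card_weight_le B :
  \sum_(k : {ffun 'I_N -> 'I_B} | ((\sum_i k i)%N%:R <= 4 * x)%R) 1 <=
    expR (x + 4 * x * ln (2 * N%:R / x)).
Proof.
pose q := x / (2 * N%:R).
have N2 : 0 < 2 * N%:R :> R by rewrite mulr_gt0.
have q01 : 0 < q <= 1.
  by rewrite divr_gt0 // ler_pdivrMr // mul1r; move: xN N0; lra.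
have q0 : 0 <= q by case/andP: q01 => /ltW.
have q2 : 2 * q <= 1.
  by rewrite /q mulrA ler_pdivrMr // mul1r ler_pM2l.
have lq : - (4 * x) * ln q = 4 * x * ln (2 * N%:R / x).
  by rewrite /q -[2 * N%:R / x]invf_div lnV ?posrE ?divr_gt0 // mulrN mulNr.
have geo n : \sum_(j < n) q ^+ j <= 1 + 2 * q.
  elim: n => [|n IH]; first by rewrite big_ord0; lra.
  rewrite big_ord_recl expr0 lerD2l.
  under eq_bigr do rewrite exprS.
  rewrite -mulr_sumr mulrC ler_wpM2r //; apply: le_trans IH _; lra.
apply: (@le_trans _ _ (\sum_(k : {ffun 'I_N -> 'I_B})
    q ^+ (\sum_i k i) * expR (- (4 * x) * ln q))).
  rewrite [leRHS](bigID (fun k : {ffun 'I_N -> 'I_B} =>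
    (\sum_i k i)%N%:R <= 4 * x)) /=.
  apply: ler_wpDr.
    by apply: sumr_ge0 => E _; rewrite mulr_ge0 ?expR_ge0 // exprn_ge0.
  by apply: ler_sum => k kx; exact: expr_weight.
rewrite -mulr_suml lq expRD ler_wpM2r ?expR_ge0 //.
have -> : \sum_(k : {ffun 'I_N -> 'I_B}) q ^+ (\sum_i k i) =
    (\sum_(j < B) q ^+ j) ^+ N.
  rewrite -[in RHS](card_ord N) -prodr_const.
  rewrite (bigA_distr_bigA (fun (_ : 'I_N) (j : 'I_B) => q ^+ j)).
  by apply: eq_bigr => k _; rewrite expr_sum.
have -> : x = N%:R * (2 * q).
  by rewrite mulrA (mulrC N%:R) /q mulrCA divff ?mulr1 // lt0r_neq0.
rewrite expRM_natl; apply: lerXn2r; rewrite ?nnegrE ?expR_ge0 //.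
  by apply: sumr_ge0 => j _; rewrite exprn_ge0.
exact: le_trans (geo B) (expR_ge1Dx _).
Qed.

(** The two exponents add up to [3 x + 4 x ln 2 + 5 x ln (N / x)], which is absorbed by
    [5 x (ln 12 + 1 + ln (N / x))]; this is the form in which the final probability is stated. *)
Lemma count_pairs_le B :
  \sum_(p : {set 'I_N} * {ffun 'I_N -> 'I_B} |
      (#|p.1|%:R <= x)%R && ((\sum_i p.2 i)%N%:R <= 4 * x)%R) 2 ^+ #|p.1| <=
    expR (5 * (x * ln (12 * expR 1 * N%:R / x))).
Proof.
rewrite -(pair_big (fun E : {set 'I_N} => #|E|%:R <= x)
  (fun k : {ffun 'I_N -> 'I_B} => (\sum_i k i)%N%:R <= 4 * x)
  (fun E _ => 2 ^+ #|E|)) /=.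
under eq_bigr do rewrite -[2 ^+ _]mulr1 -mulr_sumr.
rewrite -mulr_suml.
apply: (le_trans (ler_pM _ _ sum_pow2_card_le (card_weight_le B))).
- by apply: sumr_ge0 => E _; rewrite exprn_ge0.
- exact: sumr_ge0.
rewrite -expRD ler_expR.
have Nx : 0 < N%:R / x by rewrite divr_gt0.
have -> : 12 * expR 1 * N%:R / x = 12 * (expR 1 * (N%:R / x)) by rewrite !mulrA.
have -> : 2 * N%:R / x = 2 * (N%:R / x) by rewrite mulrA.
move: (N%:R / x) Nx => y y0.
have e0 := expR_gt0 (1 : R).
have ey0 : 0 < expR 1 * y by rewrite mulr_gt0.
have -> : ln (12 * (expR 1 * y)) = ln 12 + (1 + ln y).
  by rewrite !lnM ?posrE // expRK.
have -> : ln (2 * y) = ln 2 + ln y by rewrite lnM ?posrE.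
have l2 : 0 <= ln 2 :> R by rewrite ln_ge0 ?ler1n.
have l12 : ln 2 <= ln 12 :> R by rewrite ler_ln ?posrE ?ltr0n // ler_nat.
have h1 : x * ln 2 <= x * ln 12 by apply: ler_wpM2l => //; exact: ltW.
have h2 : 0 <= x * ln 2 by apply: mulr_ge0 => //; exact: ltW.
by rewrite !mulrDr; move: x0 h1 h2; lra.
Qed.

End counting.
(** * Measurability of [A_m] *)

Section measurability.
Import numFieldNormedType.Exports.

Lemma floor_grid_cvg (R : realType) (x : R) :
  ((Num.floor (k.+1%:R * x))%:~R / k.+1%:R : R) @[k --> \oo] --> x.
Proof.
apply: (@squeeze_cvgr _ _ _ R (fun k => x - k.+1%:R^-1) (fun=> x)).
- apply: nearW => k; have k0 : 0 < k.+1%:R :> R by rewrite ltr0n.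
  rewrite ler_pdivrMr // ler_pdivlMr // mulrBl mulVf ?lt0r_neq0 // (mulrC x).
  rewrite floor_le_tmp andbT lerBlDr ltW //.
  by have := lt_succ_floor (k.+1%:R * x); rewrite intrD.
- rewrite -[X in _ --> X]subr0; apply: cvgB; first exact: cvg_cst.
  exact: (@cvg_harmonic R).
- exact: cvg_cst.
Qed.

Lemma cvg_sumr (R : realType) (I : Type) (s : seq I) (f : I -> nat -> R) (l : I -> R) :
  (forall i, f i k @[k --> \oo] --> l i) ->
  \sum_(i <- s) f i k @[k --> \oo] --> \sum_(i <- s) l i.
Proof.
move=> H; elim: s => [|i s IH].
  by rewrite big_nil; under eq_fun do rewrite big_nil; exact: cvg_cst.
rewrite big_cons; under eq_fun do rewrite big_cons.
exact: cvgD.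
Qed.

(** The strict inequality is an open condition, so it survives approximation of [z] by
    [floor (k.+1 * z) / k.+1]. Rounding by [floor] keeps zero entries zero, and homogeneity removes
    the denominator. *)
Lemma exists_int_direction (R : realType) N (g : 'I_N -> 'I_N -> R)
    (z : 'I_N -> R) (r : R) :
  0 < Num.sqrt (sqnorm z) ->
  r * Num.sqrt (sqnorm z) < Num.sqrt (bform g z z) ->
  exists q : 'I_N -> int,
    let w i := (q i)%:~R in
    [/\ (suppn w <= suppn z)%N, 0 < Num.sqrt (sqnorm w) &
       r * Num.sqrt (sqnorm w) < Num.sqrt (bform g w w)].
Proof.
move=> z0 rz.
pose q k i : int := Num.floor (k.+1%:R * z i).
pose w k i : R := (q k i)%:~R.
pose y k i : R := k.+1%:R^-1 * w k i.
have yz i : y k i @[k --> \oo] --> z i.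
  by rewrite /y; under eq_fun do rewrite mulrC; exact: floor_grid_cvg.
have sqrtc (f : nat -> R) l : f k @[k --> \oo] --> l ->
    Num.sqrt (f k) @[k --> \oo] --> Num.sqrt l.
  move=> fl; apply: (@continuous_cvg _ _ _ _ _ _ (Num.sqrt : R -> R)) => //.
  exact: sqrt_continuous.
have c1 : Num.sqrt (sqnorm (y k)) @[k --> \oo] --> Num.sqrt (sqnorm z).
  by apply: sqrtc; apply: cvg_sumr => i; apply: cvgM.
have c2 : Num.sqrt (bform g (y k) (y k)) @[k --> \oo] --> Num.sqrt (bform g z z).
  apply: sqrtc; apply: cvg_sumr => i; apply: cvgM => //.
  by apply: cvg_sumr => j; apply: cvgM => //; exact: cvg_cst.
have c3 : Num.sqrt (bform g (y k) (y k)) - r * Num.sqrt (sqnorm (y k)) @[k --> \oo]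
    --> Num.sqrt (bform g z z) - r * Num.sqrt (sqnorm z).
  by apply: cvgB => //; apply: cvgM => //; exact: cvg_cst.
have p3 : 0 < Num.sqrt (bform g z z) - r * Num.sqrt (sqnorm z) by rewrite subr_gt0.
near \oo => k; exists (q k) => /=; rewrite -/(w k).
have k0 : 0 < k.+1%:R^-1 :> R by rewrite invr_gt0 ltr0n.
have e1 : Num.sqrt (sqnorm (y k)) = k.+1%:R^-1 * Num.sqrt (sqnorm (w k)).
  have -> : sqnorm (y k) = k.+1%:R^-1 ^+ 2 * sqnorm (w k).
    by rewrite /sqnorm mulr_sumr; apply: eq_bigr => i _; rewrite exprMn.
  by rewrite sqrtrM ?sqr_ge0 // sqrtr_sqr ger0_norm // ltW.
have e2 : Num.sqrt (bform g (y k) (y k)) =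
    k.+1%:R^-1 * Num.sqrt (bform g (w k) (w k)).
  rewrite bformZl bformZr mulrA -expr2.
  by rewrite sqrtrM ?sqr_ge0 // sqrtr_sqr ger0_norm // ltW.
split.
- by apply: suppnS => i zi; rewrite /w /q zi mulr0 floor0.
- have : 0 < Num.sqrt (sqnorm (y k)) by near: k; exact: (cvgr_gt _ c1 _ z0).
  by rewrite e1 pmulr_rgt0.
- have : 0 < Num.sqrt (bform g (y k) (y k)) - r * Num.sqrt (sqnorm (y k)).
    by near: k; exact: (cvgr_gt _ c3 _ p3).
  by rewrite subr_gt0 e1 e2 mulrCA ltr_pM2l.
Unshelve. all: by end_near. Qed.

Definition gram N n (X : 'I_N -> n.-tuple RR) (i j : 'I_N) : RR := dotp (X i) (X j).

Lemma gramC N n (X : 'I_N -> n.-tuple RR) i j : gram X i j = gram X j i.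
Proof. by apply: eq_bigr => k _; rewrite mulrC. Qed.

Lemma dotp_matA N n (X : 'I_N -> n.-tuple RR) (z : N.-tuple RR) i :
  dotp (X i) (matA X z) = rowsum (gram X) (tnth z) i.
Proof.
rewrite /dotp; under eq_bigr do rewrite tnth_mktuple mulr_sumr.
rewrite exchange_big; apply: eq_bigr => j _ /=.
by rewrite mulr_sumr; apply: eq_bigr => k _; rewrite mulrCA.
Qed.

Lemma dotp_matA_matA N n (X : 'I_N -> n.-tuple RR) (z : N.-tuple RR) :
  dotp (matA X z) (matA X z) = bform (gram X) (tnth z) (tnth z).
Proof.
rewrite /bform; under [RHS]eq_bigr do rewrite -dotp_matA /dotp mulr_sumr.
rewrite exchange_big; apply: eq_bigr => j _ /=.
rewrite {1}tnth_mktuple mulr_suml.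
by apply: eq_bigr => i _; rewrite mulrA.
Qed.

Lemma enorm_matA N n (X : 'I_N -> n.-tuple RR) (z : N.-tuple RR) :
  enorm (matA X z) = Num.sqrt (bform (gram X) (tnth z) (tnth z)).
Proof. by rewrite /enorm dotp_matA_matA. Qed.

Lemma enormE N (z : N.-tuple RR) : enorm z = Num.sqrt (sqnorm (tnth z)).
Proof. by []. Qed.

Lemma enorm_scale n (a : RR) (y : n.-tuple RR) : 0 <= a ->
  enorm [tuple a * tnth y j | j < n] = a * enorm y.
Proof.
move=> a0; rewrite /enorm.
have -> : dotp [tuple a * tnth y j | j < n] [tuple a * tnth y j | j < n] =
    a ^+ 2 * dotp y y.
  by rewrite /dotp mulr_sumr; apply: eq_bigr => j _; rewrite !tnth_mktuple; ring.
by rewrite sqrtrM ?sqr_ge0 // sqrtr_sqr ger0_norm.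
Qed.

Lemma matA_scale N n (X : 'I_N -> n.-tuple RR) (a : RR) (z : N.-tuple RR) :
  matA X [tuple a * tnth z i | i < N] = [tuple a * tnth (matA X z) j | j < n].
Proof.
apply: eq_from_tnth => j; rewrite !tnth_mktuple mulr_sumr.
by apply: eq_bigr => i _; rewrite tnth_mktuple mulrA.
Qed.

Lemma supp_cardE N (z : N.-tuple RR) : supp_card z = suppn (tnth z).
Proof. by apply: eq_card => i; rewrite !inE; exact: asboolb. Qed.

Definition intv N (q : N.-tuple int) : N.-tuple RR := [tuple (tnth q i)%:~R | i < N].

(* By homogeneity the sphere may be replaced by the countably many integer directions. *)
Lemma lt_A_m N n (X : 'I_N -> n.-tuple RR) (m : nat) (r : RR) :
  (r%:E < A_m X m)%E <->
  exists q : N.-tuple int, (suppn (tnth (intv q)) <= m)%N /\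
    enorm (intv q) != 0 /\ r * enorm (intv q) < enorm (matA X (intv q)).
Proof.
split.
  move=> /ereal_sup_gt [_ [z [z1 zm] <-]]; rewrite lte_fin => rz.
  move: rz; rewrite enorm_matA => rz.
  have z0 : 0 < Num.sqrt (sqnorm (tnth z)) by rewrite -enormE z1.
  have := @exists_int_direction RR N (gram X) (tnth z) r z0.
  rewrite -[in X in X -> _]enormE z1 mulr1 => /(_ rz)[q [qz q0 rq]].
  exists [tuple q i | i < N].
  have qE : tnth (intv [tuple q i | i < N]) = (fun i => (q i)%:~R).
    by apply/funext => i; rewrite !tnth_mktuple.
  rewrite enorm_matA enormE qE; split; last by split => //; exact: lt0r_neq0.
  by apply: leq_trans qz _; rewrite -supp_cardE.
move=> [q [qm [q0 rq]]].
have q0' : 0 < enorm (intv q) by rewrite lt_neqAle eq_sym q0 enorm_ge0.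
have q0i : 0 <= (enorm (intv q))^-1 by rewrite invr_ge0 enorm_ge0.
apply: (@lt_le_trans _ _ (enorm (matA X (unitv (intv q))))%:E).
  by rewrite lte_fin matA_scale enorm_scale // mulrC ltr_pdivlMr.
apply: ereal_sup_ubound; exists (unitv (intv q)) => //; split.
  exact: enorm_unitv.
rewrite /= supp_cardE; apply: leq_trans qm; apply: suppnS => i qi.
by rewrite tnth_mktuple qi mulr0.
Qed.

(** The non-strict event is the intersection over [k] of the strict ones with slack [1 / k.+1], each
    a countable union over integer directions. Measurability is what lets monotonicity of [P]
    compare this event with the exceptional set. *)
Lemma measurable_A_m_event d (T : measurableType d) (N n m : nat)
    (X : 'I_N -> T -> n.-tuple RR) (c : RR) :
  (forall i, measurable_fun [set: T] (X i : T -> n.-tuple RB)) ->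
  measurable [set t | ((c + 6 * max_norm (fun i => X i t))%:E
                       <= A_m (fun i => X i t) m)%E].
Proof.
move=> mX.
have mM : measurable_fun setT ((fun t => max_norm (fun i => X i t)) : T -> RB).
  rewrite /max_norm; elim: (index_enum _) => [|i s IH].
    by under eq_fun do rewrite big_nil; exact: measurable_cst.
  under eq_fun do rewrite big_cons.
  by apply: (@measurable_maxr _ _ RR) => //; exact: measurable_enorm.
pose F k (q : N.-tuple int) :=
  [set t | (c + 6 * max_norm (fun i => X i t) - k.+1%:R^-1) * enorm (intv q) <
           enorm (matA (fun i => X i t) (intv q))].
have mF k q : measurable (F k q).
  rewrite -[F k q]setTI; apply: (measurable_fun_ltr (R := RR)) => //.
    apply: measurable_funM => //; apply: measurable_funB => //.
    by apply: measurable_funD => //; apply: measurable_funM.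
  by apply: measurable_enorm; exact: measurable_matA.
pose G k (q : N.-tuple int) :=
  if (suppn (tnth (intv q)) <= m)%N && (enorm (intv q) != 0) then F k q else set0.
have -> : [set t | ((c + 6 * max_norm (fun i => X i t))%:E
    <= A_m (fun i => X i t) m)%E] = \bigcap_k \bigcup_q G k q.
  apply/seteqP; split => t /=.
    move=> cA k _.
    have : ((c + 6 * max_norm (fun i => X i t) - k.+1%:R^-1)%:E <
        A_m (fun i => X i t) m)%E.
      by apply: lt_le_trans cA; rewrite lte_fin ltrBlDr ltrDl invr_gt0 ltr0n.
    move=> /lt_A_m[q [qm [q0 H]]]; exists q => //.
    by rewrite /G qm q0.
  move=> H; apply/lee_addgt0Pr => e e0.
  pose k := Num.truncn e^-1.
  have [q _] := H k Logic.I; rewrite /G; case: ifP => // /andP[qm q0] Ft.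
  have : ((c + 6 * max_norm (fun i => X i t) - k.+1%:R^-1)%:E <
      A_m (fun i => X i t) m)%E by apply/lt_A_m; exists q.
  rewrite EFinB lteBlDr // => /ltW /le_trans; apply; rewrite leeD2l // lee_fin.
  rewrite -[leRHS]invrK lef_pV2 ?posrE ?invr_gt0 ?ltr0n //.
  exact/ltW/truncnS_gt.
apply: bigcap_measurableType => k _; apply: countable_bigcupT_measurable.
  exact: countableP.
by move=> q; rewrite /G; case: ifP => // _; exact: mF.
Qed.

End measurability.
(** * Numerical estimates *)

Section numerics.
Context (R : realType).

(** From [expR (-1/6) >= 5/6] and [(6/5)^6 = 2.985984]. *)
Lemma expR1_le3 : expR 1 <= 3 :> R.
Proof.
have h : 5 / 6 <= expR (- (1 / 6)) :> R by apply: le_trans (expR_ge1Dx _); lra.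
have h' : expR (1 / 6) <= 6 / 5 :> R.
  have -> : expR (1 / 6) = (expR (- (1 / 6)))^-1 :> R by rewrite expRN invrK.
  have -> : 6 / 5 = (5 / 6)^-1 :> R by rewrite invf_div.
  by rewrite lef_pV2 ?posrE ?expR_gt0 // divr_gt0 ?ltr0n.
have -> : 1 = 6%:R * (1 / 6) :> R by lra.
rewrite expRM_natl; apply: (@le_trans _ _ ((6 / 5) ^+ 6)); last by lra.
by apply: lerXn2r; rewrite ?nnegrE ?expR_ge0 // divr_ge0.
Qed.

Lemma expR1_ge2 : 2 <= expR 1 :> R.
Proof. by apply: le_trans (expR_ge1Dx _); lra. Qed.

Context (m N : nat).
Hypothesis mN : (1 <= m <= N)%N.

Let x (k : nat) : R := m%:R / 2 ^+ k.
Let y (k : nat) : R := ln (12 * expR 1 * N%:R / x k).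
Let lam : R := ln 2.

Let m0 : 0 < m%:R :> R. Proof. by case/andP: mN => ?; rewrite ltr0n. Qed.
Let N0 : 0 < N%:R :> R.
Proof. by case/andP: mN => h1 h2; rewrite ltr0n (leq_trans h1). Qed.
Let p2 k : 0 < 2 ^+ k :> R. Proof. by rewrite exprn_gt0. Qed.
Let x0 k : 0 < x k. Proof. by rewrite divr_gt0. Qed.
Let e0 : 0 < expR 1 :> R. Proof. exact: expR_gt0. Qed.
Let Nm : 1 <= N%:R / m%:R :> R.
Proof. by rewrite ler_pdivlMr // mul1r ler_nat; case/andP: mN. Qed.

Lemma ln2_gt0 : 0 < lam. Proof. by rewrite /lam ln_gt0 // ltr1n. Qed.

Let ln_pow2 (a : R) k : 0 < a -> a <= 2 ^+ k -> ln a <= k%:R * lam.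
Proof. by move=> a0 ak; rewrite mulr_natl -lnXn // ler_ln ?posrE. Qed.

Let ln_Npow2 (a : R) k : 0 < a -> 2 ^+ k <= a -> k%:R * lam <= ln a.
Proof. by move=> a0 ak; rewrite mulr_natl -lnXn // ler_ln ?posrE. Qed.

Lemma ln_2Nm_ge : lam <= ln (2 * N%:R / m%:R).
Proof.
have Nm0 : 0 < N%:R / m%:R :> R by rewrite divr_gt0.
have h : 0 < 2 * (N%:R / m%:R) :> R by apply: mulr_gt0.
rewrite -mulrA /lam ler_ln ?posrE //.
by move: Nm; lra.
Qed.

(** Normal form for all logarithms of this part: a constant, [ln (2N/m) >= ln 2], and a multiple of
    [ln 2], so that the comparisons become linear. *)
Lemma level_lnE c k : 0 < c ->
  ln (c * N%:R / x k) = ln (c / 2) + ln (2 * N%:R / m%:R) + k%:R * lam.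
Proof.
move=> c0; have Nm0 : 0 < N%:R / m%:R :> R by rewrite divr_gt0.
have c2 : 0 < c / 2 by rewrite divr_gt0.
have -> : c * N%:R / x k = (c / 2) * (2 * N%:R / m%:R) * 2 ^+ k.
  by rewrite /x invf_div; field; rewrite lt0r_neq0.
have a2 : 0 < 2 * N%:R / m%:R :> R by rewrite -mulrA mulr_gt0.
have ca : 0 < c / 2 * (2 * N%:R / m%:R) by rewrite mulr_gt0.
by rewrite (lnM ca (p2 k)) (lnM c2 a2) lnXn // [k%:R * _]mulr_natl.
Qed.

(** Three units of [lam] come from [6 e >= 8], one from [2N/m >= 2]. The factor 4 yields
    [y k.+1 <= 5/4 * y k]. *)
Let y_ge k : 4 * lam <= y k.
Proof.
have c0 : 0 < 12 * expR 1 :> R by rewrite mulr_gt0.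
rewrite /y level_lnE //.
have h1 : 3%:R * lam <= ln (12 * expR 1 / 2).
  apply: ln_Npow2; first by rewrite divr_gt0.
  by have := expR1_ge2; lra.
have := ln_2Nm_ge; have := ln2_gt0.
have : 0 <= k%:R * lam by rewrite mulr_ge0 // ltW // ln2_gt0.
by lra.
Qed.

Let yS k : y k.+1 = y k + lam.
Proof.
have c0 : 0 < 12 * expR 1 :> R by rewrite mulr_gt0.
by rewrite /y !level_lnE // -natr1; ring.
Qed.

Let xS k : x k.+1 = x k / 2.
Proof. by rewrite /x exprSr invfM mulrA. Qed.

(** Halving [x] outweighs adding [lam] to [y]. Hence the tail estimate at the last level also covers
    all earlier ones. *)
Lemma level_entropy_le k l : (k <= l)%N -> x l * y l <= x k * y k.
Proof.
move=> kl; rewrite -(subnK kl); elim: (l - k)%N => // j IH.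
apply: le_trans IH; rewrite addSn xS yS -mulrA ler_pM2l //.
by have := y_ge (j + k); have := ln2_gt0; lra.
Qed.

Lemma level_entropy_ge k : x k * y k <= 2 * (x k.+1 * y k.+1).
Proof.
rewrite xS yS; have h : 0 <= x k * lam.
  by apply: mulr_ge0; apply: ltW => //; exact: ln2_gt0.
by move: h; lra.
Qed.

Let sqrt_half : Num.sqrt 2^-1 <= 71 / 100 :> R.
Proof.
have -> : 71 / 100 = Num.sqrt ((71 / 100) ^+ 2) :> R.
  by rewrite sqrtr_sqr ger0_norm // divr_ge0.
by apply: ler_wsqrtr; lra.
Qed.

Let s k := Num.sqrt (x k) * y k.

Let s_ge0 k : 0 <= s k.
Proof.
by rewrite mulr_ge0 ?sqrtr_ge0 //; have := y_ge k; have := ln2_gt0; lra.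
Qed.

(** The ratio is at most [sqrt (1/2) * 5/4 <= 0.71 * 1.25 < 0.9]. *)
Let s_decay k : s k.+1 <= 9 / 10 * s k.
Proof.
rewrite /s xS yS sqrtrM ?(ltW (x0 k)) //.
have h : Num.sqrt 2^-1 * (y k + lam) <= 71 / 100 * (5 / 4 * y k).
  apply: ler_pM => //.
    by have := y_ge k; have := ln2_gt0; lra.
  by have := y_ge k; lra.
apply: (@le_trans _ _ (Num.sqrt (x k) * (9 / 10 * y k))); last by rewrite mulrCA.
rewrite -mulrA; apply: ler_wpM2l; first exact: sqrtr_ge0.
apply: le_trans h _.
by have := y_ge k; have := ln2_gt0; lra.
Qed.

Lemma level_sum_le l :
  \sum_(k < l) Num.sqrt (2 / x k) * (x k * y k) <=
    140 * (Num.sqrt m%:R * ln (2 * N%:R / m%:R)).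
Proof.
have h1 : \sum_(k < l) Num.sqrt (2 / x k) * (x k * y k) <= \sum_(k < l) 2 * s k.
  apply: ler_sum => k _.
  have -> : Num.sqrt (2 / x k) * (x k * y k) = Num.sqrt 2 * s k.
    rewrite /s -{2}(sqr_sqrtr (ltW (x0 k))) sqrtrM // sqrtrV ?(ltW (x0 k)) //.
    have : Num.sqrt (x k) != 0 by rewrite lt0r_neq0 // sqrtr_gt0.
    by move=> ?; field.
  apply: ler_wpM2r => //.
  apply: (@le_trans _ _ (Num.sqrt (2 ^+ 2))); first by apply: ler_wsqrtr; lra.
  by rewrite sqrtr_sqr ger0_norm.
(* Geometric sum in telescoped form: [s k <= 10 * (s k - s k.+1)]. With the factor 7 below this
   gives 140. *)
have h2 : \sum_(k < l) 2 * s k <= 20 * (s 0%N - s l).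
  elim: l {h1} => [|l IH]; first by rewrite big_ord0 subrr mulr0.
  rewrite big_ord_recr /=; have := s_decay l; have := s_ge0 l; move: IH; lra.
have h3 : s 0%N <= 7 * (Num.sqrt m%:R * ln (2 * N%:R / m%:R)).
  rewrite /s /x expr0 divr1 mulrCA ler_wpM2l ?sqrtr_ge0 // /y level_lnE ?mulr_gt0 //.
  (* [6 e <= 18 <= 2 ^ 6], and [lam <= ln (2N/m)], whence the factor [6 + 1]. *)
  have c1 : ln (12 * expR 1 / 2) <= 6%:R * lam.
    apply: ln_pow2; first by rewrite divr_gt0 ?mulr_gt0.
    by have := expR1_le3; lra.
  by have := ln_2Nm_ge; rewrite mul0r addr0; lra.
by have := s_ge0 l; lra.
Qed.

(** The number 1.74 is just above [sqrt 3]. The base case is [1.74 * 8 = 13.92], and the step works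
    because [1.74 * 9 <= 2 * 8]. *)
Let pow_bound j : (174 / 100) ^+ j.+1 * (8 + j%:R) <= 14 * 2 ^+ j :> R.
Proof.
elim: j => [|j IH]; first by rewrite expr1 expr0 mulr0n addr0; lra.
rewrite exprSr -(natr1 j) [2 ^+ j.+1]exprSr.
have p0 : 0 < (174 / 100) ^+ j.+1 :> R by rewrite exprn_gt0 // divr_gt0.
have j0 : 0 <= j%:R :> R by [].
move: ((174 / 100) ^+ j.+1) (2 ^+ j) (j%:R : R) p0 j0 IH => p a J p0 j0 IH.
have : p * (174 / 100 * (9 + J)) <= p * (2 * (8 + J)).
  by apply: ler_wpM2l; [exact: ltW|lra].
by move: IH; lra.
Qed.

(* The largest [l <= ln m] for which the second inequality holds; when the
   constraint [l <= ln m] is the active one, [2 ^+ l] is of larger order than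
   [sqrt m * l] because [sqrt 3 < 2] and [m < 3 ^+ l.+1]. *)
Lemma exists_level : exists l : nat,
  [/\ l%:R <= ln (m%:R : R),
    Num.sqrt m%:R * ln (2 * N%:R / m%:R) <= 2 * (x l * y l) &
    x l * ln (48 * expR 1 * N%:R / x l) <=
      14 * (Num.sqrt m%:R * ln (2 * N%:R / m%:R))].
Proof.
set D := Num.sqrt m%:R * _.
have sm0 : 0 < Num.sqrt m%:R :> R by rewrite sqrtr_gt0.
have D0 : 0 <= D.
  by rewrite mulr_ge0 ?(ltW sm0) // (le_trans _ ln_2Nm_ge) // ltW // ln2_gt0.
pose p l := (l%:R <= ln (m%:R : R)) && (D <= 2 * (x l * y l)).
have m1 : 1 <= m%:R :> R by rewrite ler1n; case/andP: mN.
have exp : exists l, p l.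
  exists 0%N; rewrite /p ln_ge0 //= /D /x expr0 divr1.
  have h1 : Num.sqrt m%:R <= m%:R :> R.
    rewrite -{2}(sqr_sqrtr (ltW m0)) expr2 ler_peMl ?(ltW sm0) //.
    by have := ler_wsqrtr m1; rewrite sqrtr1.
  have h2 : ln (2 * N%:R / m%:R) <= y 0%N.
    have c0 : 0 < 12 * expR 1 :> R by rewrite mulr_gt0.
    rewrite /y level_lnE // mul0r addr0 lerDr ln_ge0 //.
    by have := expR1_ge2; lra.
  have h3 : 0 <= m%:R * y 0%N.
    by rewrite mulr_ge0 //; have := y_ge 0; have := ln2_gt0; lra.
  apply: (@le_trans _ _ (m%:R * y 0%N)); last by lra.
  apply: ler_pM => //.
  by rewrite (le_trans _ ln_2Nm_ge) // ltW // ln2_gt0.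
have ubp l : p l -> (l <= m)%N.
  move=> /andP[h _]; rewrite -(ler_nat R); apply: le_trans h _.
  exact/ltW/ln_sublinear.
case: (ex_maxnP exp ubp) => l /andP[l1 l2] lmax.
exists l; split => //.
have ly48 : ln (48 * expR 1 * N%:R / x l) = 2 * lam + y l.
  rewrite /y !level_lnE ?mulr_gt0 //.
  have -> : 48 * expR 1 / 2 = 2 ^+ 2 * (12 * expR 1 / 2) :> R by ring.
  have h : 0 < 12 * expR 1 / 2 :> R by rewrite divr_gt0 ?mulr_gt0.
  by rewrite (lnM (p2 2) h) lnXn // -/lam; ring.
(* If [l.+1] still satisfies the logarithmic constraint, maximality makes the other condition fail
   there, so [D > 2 x_{l+1} y_{l+1} >= x_l y_l]; replacing 12 by 48 at most doubles the logarithm.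
   Otherwise [ln m < l + 1]. *)
have [lS|lS] := leP l.+1%:R (ln (m%:R : R)).
  have : ~~ p l.+1 by apply/negP => /lmax; rewrite ltnn.
  rewrite /p lS /= -ltNge => h; have := level_entropy_ge l => h'.
  have : x l * ln (48 * expR 1 * N%:R / x l) <= x l * (2 * y l).
    by apply: ler_wpM2l; rewrite ?(ltW (x0 l)) // ly48; have := y_ge l; have := ln2_gt0; lra.
  by move: h h'; lra.
have mle : m%:R <= (174 / 100) ^+ 2 ^+ l.+1 :> R.
  apply: (@le_trans _ _ (3 ^+ l.+1)).
    apply: (@le_trans _ _ (expR 1 ^+ l.+1)).
      by rewrite -expRM_natr mul1r -[leLHS]lnK ?posrE // ler_expR ltW.
    by apply: lerXn2r; rewrite ?nnegrE ?expR_ge0 // expR1_le3.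
  by apply: lerXn2r; rewrite ?nnegrE ?exprn_ge0 ?divr_ge0 //; lra.
have smle : Num.sqrt m%:R <= (174 / 100) ^+ l.+1 :> R.
  rewrite -[leRHS]ger0_norm ?exprn_ge0 ?divr_ge0 // -sqrtr_sqr ler_wsqrtr //.
  by rewrite -exprM mulnC exprM.
have key : Num.sqrt m%:R * (8 + l%:R) <= 14 * 2 ^+ l :> R.
  by apply: le_trans (pow_bound l); rewrite ler_wpM2r // addr_ge0.
(* [24 e <= 72 <= 2 ^ 7]; the factor 8 is 7 plus the term [ln (2N/m)] itself. *)
have ly : ln (48 * expR 1 * N%:R / x l) <= (8 + l%:R) * ln (2 * N%:R / m%:R).
  rewrite level_lnE ?mulr_gt0 //.
  have c1 : ln (48 * expR 1 / 2) <= 7%:R * lam.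
    apply: ln_pow2; first by rewrite divr_gt0 ?mulr_gt0.
    by have := expR1_le3; lra.
  have c2 : l%:R * lam <= l%:R * ln (2 * N%:R / m%:R) by rewrite ler_wpM2l // ln_2Nm_ge.
  have c3 := ln_2Nm_ge; rewrite (mulrDl 8); move: c1 c2 c3.
  move: (ln (48 * expR 1 / 2)) (ln (2 * N%:R / m%:R)) (l%:R : R) => a b J.
  by lra.
apply: le_trans (ler_wpM2l (ltW (x0 l)) ly) _.
rewrite /x -{1}(sqr_sqrtr (ltW m0)) expr2.
have -> : Num.sqrt m%:R * Num.sqrt m%:R / 2 ^+ l *
    ((8 + l%:R) * ln (2 * N%:R / m%:R)) =
    (Num.sqrt m%:R * (8 + l%:R) / 2 ^+ l) * D.
  by rewrite /D; field; rewrite lt0r_neq0.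
by apply: ler_wpM2r => //; rewrite ler_pdivrMr.
Qed.

End numerics.
(** * Tail of [A_m] *)

(** The strict gap [psi < c] provides an admissible constant below [c] without asking whether the
    infimum is attained; it is used with [c = 2 psi]. *)
Lemma psi1_norm_integral_le d (T : measurableType d) (P : probability T RR)
    (Y : T -> RR) (psi c : RR) :
  measurable_fun setT (Y : T -> RB) -> psi < c ->
  (psi1_norm P Y <= psi%:E)%E ->
  (\int[P]_t (expR (`|Y t| / c))%:E <= 2%:E)%E.
Proof.
move=> mY pc Yp; have : (psi1_norm P Y < c%:E)%E by apply: le_lt_trans Yp _.
move=> /ereal_inf_lt [_ [c' [c'0 Hc'] <-]]; rewrite lte_fin => c'c.
apply: le_trans Hc'.
have mE (a : RR) : measurable_fun setT (fun t => (expR (`|Y t| / a))%:E).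
  apply/measurable_EFinP; apply: (measurableT_comp (@measurable_expR RR)).
  apply: measurable_funM => //.
  exact: (measurableT_comp (@normr_measurable RR _)).
apply: ge0_le_integral => //.
move=> t _; rewrite lee_fin ler_expR; apply: ler_wpM2l => //.
by rewrite lef_pV2 ?posrE ?ltW // (lt_trans c'0).
Qed.

Section level.
Context (n N : nat) (d : measure_display) (T : measurableType d)
  (P : probability T RR) (X : 'I_N -> T -> n.-tuple RR).
Hypothesis mX : forall i, measurable_fun [set: T] (X i : T -> n.-tuple RB).
Hypothesis indX : mutually_independent P X.

(** Union bound over pairs of a set [E] and an integer vector vanishing on [E], which makes
    [decoupled_tail] applicable. The exponent is entropy minus [L / c]. *)
Lemma level_event (c L x : RR) : 0 < c -> 0 < x -> x <= N%:R ->
  (forall (i : 'I_N) (y : n.-tuple RR), enorm y = 1 ->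
    (\int[P]_t (expR (`|dotp (X i t) y| / c))%:E <= 2%:E)%E) ->
  exists U : set T, [/\ measurable U,
    (P U <= (expR (5 * (x * ln (12 * expR 1 * N%:R / x)) - L / c))%:E)%E &
    forall t, ~ U t -> forall (E : {set 'I_N}) (k : 'I_N -> nat),
      #|E|%:R <= x -> (forall i, i \in E -> k i = 0%N) ->
      (\sum_i k i)%:R <= 4 * x ->
      let w i : RR := (k i)%:R in
      rowsum_norm (gram (fun i => X i t)) E w <=
        L * Num.sqrt (bform (gram (fun i => X i t)) w w)].
Proof.
move=> c0 x0 xN Xc.
(* Every entry of an admissible vector is at most [4 x <= 4 N], so finite functions into ['I_B]
   capture them all. *)
pose B := (4 * N).+1.
pose z (k : {ffun 'I_N -> 'I_B}) : N.-tuple RR := [tuple (k i)%:R | i < N].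
pose Y k t := matA (fun j => X j t) (z k).
pose A (p : {set 'I_N} * {ffun 'I_N -> 'I_B}) : set T :=
  [set t | L * enorm (Y p.2 t) < \sum_(i in p.1) `|dotp (X i t) (Y p.2 t)|].
pose adm (p : {set 'I_N} * {ffun 'I_N -> 'I_B}) :=
  (#|p.1|%:R <= x) && ((\sum_i p.2 i)%N%:R <= 4 * x).
pose dis (p : {set 'I_N} * {ffun 'I_N -> 'I_B}) :=
  [forall i, (i \in p.1) ==> (p.2 i == 0 :> nat)].
have [|U [mU AU PU]] := @finite_union_bound _ T RR P _
    (fun p => adm p && dis p) A (fun p => 2 ^+ #|p.1| * expR (- (L / c))).
  move=> [E k] /andP[_ /forallP H]; apply: decoupled_tail => //.
  by move=> i iE; rewrite tnth_mktuple; have := H i; rewrite /= iE => /eqP ->.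
exists U; split => //.
  apply: le_trans PU _; rewrite lee_fin expRD -mulr_suml ler_wpM2r ?expR_ge0 //.
  apply: le_trans (count_pairs_le x0 xN B).
  rewrite -/adm [leRHS](bigID dis) /=.
  by apply: ler_wpDr => //; apply: sumr_ge0 => p _; rewrite exprn_ge0.
move=> t Ut E k Ex kE ks /=; pose w i : RR := (k i)%:R; rewrite -/w.
have kB i : (k i < B)%N.
  rewrite ltnS -(ler_nat RR); apply: (@le_trans _ _ (\sum_i k i)%:R).
    by rewrite ler_nat (bigD1 i) //= leq_addr.
  by apply: le_trans ks _; rewrite natrM ler_wpM2l.
pose f : {ffun 'I_N -> 'I_B} := [ffun i => inord (k i)].
have fk i : f i = k i :> nat by rewrite ffunE inordK.
have zw : tnth (z f) = w by apply/funext => i; rewrite tnth_mktuple fk.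
have : ~ A (E, f) t.
  move=> /AU H; apply: Ut; apply: H; rewrite /adm /dis /= Ex.
  have -> : (\sum_i f i = \sum_i k i)%N by apply: eq_bigr => i _; exact: fk.
  by rewrite ks; apply/forallP => i; apply/implyP => /kE; rewrite fk => ->.
rewrite /A /= /Y => /negP; rewrite -leNgt.
under eq_bigr do rewrite dotp_matA zw.
by rewrite enorm_matA zw.
Qed.

End level.

(** Otherwise [a - 32 S > M], hence [a (a - 32 S) > a M >= M ^ 2], against the hypothesis. *)
Lemma quadratic_root_lt (R : realFieldType) (a M S c : R) :
  0 <= a -> 0 <= M -> 0 <= S -> a ^+ 2 <= M ^+ 2 + 32 * S * a ->
  32 * S < c -> a < c + 6 * M.
Proof.
move=> a0 M0 S0 a2 Sc; have [//|h] := ltP a (c + 6 * M).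
have Ma : M < a - 32 * S by lra.
have a0' : 0 < a by lra.
have h1 : a * M < a * (a - 32 * S) by rewrite ltr_pM2l.
have h2 : M * M <= a * M by apply: ler_wpM2r => //; lra.
by move: a2 h1 h2; rewrite !expr2; lra.
Qed.

(** * Deterministic bound on [A_m] outside the exceptional events *)

Section deterministic.
Context (n N m : nat) (X : 'I_N -> n.-tuple RR).
Hypothesis mN : (1 <= m <= N)%N.

Let le_A_m (z : N.-tuple RR) : enorm z = 1 -> (supp_card z <= m)%N ->
  ((enorm (matA X z))%:E <= A_m X m)%E.
Proof. by move=> z1 zm; apply: ereal_sup_ubound; exists z. Qed.

Let exists_unit : exists z : N.-tuple RR, enorm z = 1 /\ (supp_card z <= m)%N.
Proof.
have N0 : (0 < N)%N by case/andP: mN => h1 h2; exact: leq_trans h2.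
pose i0 := Ordinal N0.
exists [tuple (i == i0)%:R | i < N]; split.
  rewrite enormE /sqnorm (bigD1 i0) //= tnth_mktuple eqxx expr1n big1 ?addr0 ?sqrtr1 //.
  by move=> i /negbTE ii; rewrite tnth_mktuple ii expr0n.
rewrite supp_cardE; case/andP: mN => m1 _; apply: leq_trans m1.
rewrite /suppn.
set p := [pred i | _]; have /fintype.eq_card1 -> // : p =i pred1 i0.
move=> i; rewrite !inE tnth_mktuple.
by case: (i == i0); rewrite ?oner_eq0 ?eqxx.
Qed.

Lemma A_m_ge0 : (0%:E <= A_m X m)%E.
Proof.
have [z [z1 zm]] := exists_unit.
by apply: le_trans (le_A_m z1 zm); rewrite lee_fin enorm_ge0.
Qed.

Lemma enorm_le_A_m (z : N.-tuple RR) : sqnorm (tnth z) <= 1 ->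
  (suppn (tnth z) <= m)%N -> ((enorm (matA X z))%:E <= A_m X m)%E.
Proof.
move=> z1 zm.
have zle : enorm z <= 1 by rewrite enormE; have := ler_wsqrtr z1; rewrite sqrtr1.
have [z0|z0] := eqVneq (enorm z) 0.
  suff -> : enorm (matA X z) = 0 by exact: A_m_ge0.
  have zi i : tnth z i = 0.
    apply/eqP; rewrite -[_ == 0](@expf_eq0 _ _ 2).
    have := sqr_enorm z; rewrite z0 expr0n /= => /esym/eqP.
    rewrite psumr_eq0 => [/allP/(_ i)|j _]; last by rewrite -expr2 sqr_ge0.
    by rewrite mem_index_enum -expr2 => /(_ isT).
  rewrite enorm_matA /bform big1 ?sqrtr0 // => i _.
  by rewrite zi mul0r.
have z0' : 0 < enorm z by rewrite lt_neqAle eq_sym z0 enorm_ge0.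
have u := @le_A_m (unitv z) (enorm_unitv z0).
apply: (@le_trans _ _ (enorm (matA X (unitv z)))%:E).
  rewrite matA_scale enorm_scale ?invr_ge0 ?enorm_ge0 // lee_fin mulrC.
  by rewrite ler_pdivlMr // ler_piMr // enorm_ge0.
apply: u; rewrite supp_cardE; apply: leq_trans zm; apply: suppnS => i zi.
by rewrite tnth_mktuple zi mulr0.
Qed.

Let bform_gram_ge0 (w : 'I_N -> RR) : 0 <= bform (gram X) w w.
Proof.
pose z : N.-tuple RR := [tuple w i | i < N].
have <- : tnth z = w by apply/funext => i; rewrite tnth_mktuple.
by rewrite -dotp_matA_matA dotp_ge0.
Qed.

(** Needed before the self-bounding inequality for [A_m] can be solved over the reals; a crude bound
    by all Gram entries is enough. *)
Let A_m_fin : A_m X m \is a fin_num.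
Proof.
rewrite ge0_fin_numE; last exact: A_m_ge0.
apply: (@le_lt_trans _ _ (Num.sqrt (\sum_i \sum_j `|gram X i j|))%:E); last by rewrite ltry.
apply: ub_ereal_sup => _ [z [z1 _] <-]; rewrite lee_fin enorm_matA ler_wsqrtr //.
have zi i : `|tnth z i| <= 1.
  rewrite -(@expr_le1 _ 2) // real_normK ?num_real //.
  have : sqnorm (tnth z) = 1.
    by have := sqr_enorm z; rewrite z1 expr1n /dotp => ->; apply: eq_bigr => j _.
  move=> <-; rewrite /sqnorm (bigD1 i) //= lerDl.
  by apply: sumr_ge0 => j _; exact: sqr_ge0.
apply: ler_sum => i _; apply: le_trans (ler_norm _) _; rewrite normrM.
apply: (@le_trans _ _ `|rowsum (gram X) (tnth z) i|); first by rewrite ler_piMl.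
apply: le_trans (ler_norm_sum _ _ _) _; apply: ler_sum => j _.
by rewrite normrM ler_piMl.
Qed.

(** [A_m] itself is the radius [a] of the net argument, since every level has [x k <= m]; this gives
    [a ^ 2 <= M ^ 2 + 32 S a]. The constant is [8 * 4], from [bform_diag_le] and [bform_le_net]. *)
Lemma A_m_bound (l : nat) (L : nat -> RR) (c : RR) :
  let x k : RR := m%:R / 2 ^+ k in
  let al k : RR := if (k < l)%N then Num.sqrt (2 / x k) else 1 in
  (forall k, 0 <= L k) ->
  (forall k, (k <= l)%N -> forall (E : {set 'I_N}) (q : 'I_N -> nat),
      #|E|%:R <= x k -> (forall i, i \in E -> q i = 0%N) ->
      (\sum_i q i)%:R <= 4 * x k ->
      let w i : RR := (q i)%:R in
      rowsum_norm (gram X) E w <= L k * Num.sqrt (bform (gram X) w w)) ->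
  32 * \sum_(k < l.+1) al k * L k < c ->
  (A_m X m < (c + 6 * max_norm X)%:E)%E.
Proof.
move=> x al L0 H Sc.
have m1 : (0 < m)%N by case/andP: mN.
set a := fine (A_m X m); have aE : A_m X m = a%:E by rewrite fineK.
have a0 : 0 <= a by rewrite -lee_fin -aE; exact: A_m_ge0.
have m0 : 0 < m%:R :> RR by rewrite ltr0n; case/andP: mN.
have x0 k : 0 < x k by rewrite divr_gt0 // exprn_gt0.
have xm k : x k <= m%:R.
  by rewrite ler_pdivrMr ?exprn_gt0 // ler_peMr ?(ltW m0) // exprn_ege1 // ler1n.
have ball (w : 'I_N -> RR) : sqnorm w <= 1 -> (suppn w)%:R <= m%:R :> RR ->
    bform (gram X) w w <= a ^+ 2.
  move=> w1; rewrite ler_nat => wm.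
  pose z : N.-tuple RR := [tuple w i | i < N].
  have zw : tnth z = w by apply/funext => i; rewrite tnth_mktuple.
  have := @enorm_le_A_m z; rewrite zw => /(_ w1 wm).
  rewrite aE lee_fin enorm_matA zw => h.
  by rewrite -(sqr_sqrtr (bform_gram_ge0 w)) ler_sqr ?nnegrE ?sqrtr_ge0.
have al0 k : 0 <= al k by rewrite /al; case: ifP => // _; exact: sqrtr_ge0.
set M := max_norm X.
have M0 : 0 <= M.
  by rewrite /M /max_norm; elim/big_ind: _ => [//|u v u0 v0|i _];
    [rewrite le_max u0|exact: enorm_ge0].
have gM i : gram X i i <= M ^+ 2.
  rewrite /gram -sqr_enorm ler_sqr ?nnegrE ?enorm_ge0 //.
  by rewrite /M /max_norm (bigD1 i) //= le_max lexx.
set S := \sum_(k < l.+1) al k * L k in Sc.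
have S0 : 0 <= S by apply: sumr_ge0 => k _; rewrite mulr_ge0.
have main (z : N.-tuple RR) : enorm z = 1 -> (supp_card z <= m)%N ->
    enorm (matA X z) ^+ 2 <= M ^+ 2 + 32 * S * a.
  move=> z1 zm; rewrite enorm_matA sqr_sqrtr //.
  have z1' : sqnorm (tnth z) = 1.
    by have := sqr_enorm z; rewrite z1 expr1n /dotp => ->; apply: eq_bigr => j _.
  rewrite supp_cardE in zm.
  have := @bform_diag_le RR N (gram X) (gramC X) (tnth z) m l (M ^+ 2)
    (fun k => 4 * al k * L k * a).
  rewrite -/x -/al => /(_ m1 z1' zm gM) bd.
  apply: le_trans (bd _) _; last first.
    rewrite lerD2l le_eqVlt; apply/orP; left; apply/eqP.
    by rewrite /S !mulr_sumr mulr_suml; apply: eq_bigr => k _; ring.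
  move=> k u v kl ux vx uv ua v1.
  apply: (@bform_le_net RR N (gram X) (finset (fun i => u i != 0)) (x k)) => //.
  - move=> q qE _ qx; apply: H => //.
    apply: le_trans ux; rewrite ler_nat /suppn; apply: subset_leq_card.
    by apply/fintype.subsetP => i; rewrite !inE.
  - by move=> w w1 wx; apply: ball => //; exact: le_trans wx (xm k).
  - by move=> i; rewrite inE negbK => /eqP.
  - by move=> i; rewrite inE; have [->|//] := uv i; rewrite eqxx.
have a2 : a ^+ 2 <= M ^+ 2 + 32 * S * a.
  have r0 : 0 <= M ^+ 2 + 32 * S * a by rewrite addr_ge0 ?sqr_ge0 // !mulr_ge0.
  rewrite -[leRHS]sqr_sqrtr // ler_sqr ?nnegrE ?sqrtr_ge0 // -lee_fin -aE.
  apply: ub_ereal_sup => _ [z [z1 zm] <-]; rewrite lee_fin.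
  rewrite -[leLHS]ger0_norm ?enorm_ge0 // -sqrtr_sqr ler_wsqrtr //.
  exact: main.
rewrite aE lte_fin.
exact: quadratic_root_lt a2 Sc.
Qed.

End deterministic.

(** * Probability estimate and the choice of constants *)

Section main.
Context (n N m : nat) (d : measure_display) (T : measurableType d)
  (P : probability T RR) (X : 'I_N -> T -> n.-tuple RR) (psi : RR).
Hypothesis mX : forall i, measurable_fun [set: T] (X i : T -> n.-tuple RB).
Hypothesis indX : mutually_independent P X.
Hypothesis psi0 : 0 < psi.
Hypothesis psi1X : forall (i : 'I_N) (y : n.-tuple RR), enorm y = 1 ->
  (psi1_norm P (fun t => dotp (X i t) y) <= psi%:E)%E.
Hypothesis mN : (1 <= m <= N)%N.

Lemma level_tail (l : nat) (K c : RR) : 1 <= K ->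
  10 ^+ 5 * psi * K * (m%:R / 2 ^+ l * ln (48 * expR 1 * N%:R * 2 ^+ l / m%:R)
    + Num.sqrt m%:R * ln (2 * N%:R / m%:R)) <= c ->
  (P [set t | ((c + 6 * max_norm (fun i => X i t))%:E
               <= A_m (fun i => X i t) m)%E]
   <= ((1 + 2 * l%:R) *
       expR (- (2 * K * (m%:R / 2 ^+ l)
                * ln (12 * expR 1 * N%:R * 2 ^+ l / m%:R))))%:E)%E.
Proof.
move=> K1 cK.
pose x k : RR := m%:R / 2 ^+ k.
pose y k : RR := ln (12 * expR 1 * N%:R / x k).
have xE (b : RR) k : b * N%:R * 2 ^+ k / m%:R = b * N%:R / x k.
  by rewrite /x invf_div mulrA.
rewrite xE -/(x l) in cK; rewrite xE -/(x l) -/(y l).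
have K0 : 0 < K by apply: lt_le_trans K1.
have m0 : 0 < m%:R :> RR by rewrite ltr0n; case/andP: mN.
have N0 : 0 < N%:R :> RR by rewrite (lt_le_trans m0) // ler_nat; case/andP: mN.
have x0 k : 0 < x k by rewrite divr_gt0 // exprn_gt0.
have xm k : x k <= m%:R.
  by rewrite ler_pdivrMr ?exprn_gt0 // ler_peMr ?(ltW m0) // exprn_ege1 // ler1n.
have xN k : x k <= N%:R.
  by apply: le_trans (xm k) _; rewrite ler_nat; case/andP: mN.
have c0 : 0 < 2 * psi by rewrite mulr_gt0.
have Xc (i : 'I_N) (u : n.-tuple RR) : enorm u = 1 ->
    (\int[P]_t (expR (`|dotp (X i t) u| / (2 * psi)))%:E <= 2%:E)%E.
  move=> u1; apply: psi1_norm_integral_le (psi1X i u1).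
    by apply: measurable_dotp => //; exact: measurable_cst.
  by rewrite ltr_pMl // ltr1n.
(* With scale [2 psi] the exponent is [5 x y - 7 K x y <= - 2 K x y], as [K >= 1]: five units pay
   for the entropy, two remain. *)
pose L k : RR := 14 * psi * K * (x k * y k).
have xy0 k : 0 <= x k * y k.
  rewrite mulr_ge0 ?(ltW (x0 k)) // /y ln_ge0 //.
  rewrite ler_pdivlMr // mul1r; apply: le_trans (xN k) _.
  rewrite ler_peMl ?(ltW N0) //.
  apply: (@le_trans _ _ (12 * 2)); first by rewrite -natrM ler1n.
  by rewrite ler_wpM2l // expR1_ge2.
have psiK : 0 <= psi * K by rewrite mulr_ge0 // ltW.
have L0 k : 0 <= L k by rewrite mulr_ge0 // -mulrA mulr_ge0.
(* The condition [k <= l] sits under the existential so that [choice] can select an event for every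
   natural number. *)
have evE k : exists U : set T, (k <= l)%N -> [/\ measurable U,
    (P U <= (expR (- (2 * K * x l * y l)))%:E)%E &
    forall t, ~ U t -> forall (E : {set 'I_N}) (q : 'I_N -> nat),
      #|E|%:R <= x k -> (forall i, i \in E -> q i = 0%N) ->
      (\sum_i q i)%:R <= 4 * x k ->
      let w i : RR := (q i)%:R in
      rowsum_norm (gram (fun i => X i t)) E w <=
        L k * Num.sqrt (bform (gram (fun i => X i t)) w w)].
  have [U [mU PU HU]] := level_event mX indX (L k) c0 (x0 k) (xN k) Xc.
  exists U => kl; split => //; apply: le_trans PU _; rewrite lee_fin ler_expR.
  have mono : x l * y l <= x k * y k := @level_entropy_le RR m N mN k l kl.
  have -> : L k / (2 * psi) = 7 * K * (x k * y k).
    by rewrite /L; field; rewrite lt0r_neq0.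
  have h1 : x k * y k <= K * (x k * y k) by rewrite ler_peMl.
  have h2 : K * (x l * y l) <= K * (x k * y k) by rewrite ler_wpM2l // ltW.
  rewrite -/(y k) -[2 * K * x l * y l]mulrA -[2 * K * (x l * y l)]mulrA.
  move: h1 h2; rewrite -[7 * K * _]mulrA.
  move: (x k * y k) (K * (x k * y k)) (K * (x l * y l)) => a1 a2 a3.
  by lra.
have [ev Hev] := choice evE.
have [|U [mU evU PU]] := @finite_union_bound _ T RR P 'I_l.+1 xpredT
    (fun k => ev k) (fun=> expR (- (2 * K * x l * y l))).
  by move=> k _; have [|mk Pk _] := Hev k; first by rewrite -ltnS.
have SL : 32 * \sum_(k < l.+1)
    (if (k < l)%N then Num.sqrt (2 / x k) else 1) * L k < c.
  rewrite big_ord_recr /= ltnn mul1r.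
  under eq_bigr do rewrite ltn_ord.
  have -> : \sum_(k < l) Num.sqrt (2 / x k) * L k =
      14 * psi * K * \sum_(k < l) Num.sqrt (2 / x k) * (x k * y k).
    by rewrite mulr_sumr; apply: eq_bigr => k _; rewrite mulrCA.
  have S1 := @level_sum_le RR m N mN l; rewrite -/x in S1.
  set D := Num.sqrt _ * ln _ in S1 cK.
  have D0 : 0 < D.
    rewrite mulr_gt0 ?sqrtr_gt0 // (lt_le_trans (ln2_gt0 RR)) //.
    exact: ln_2Nm_ge.
  have y48 : x l * y l <= x l * ln (48 * expR 1 * N%:R / x l).
    rewrite ler_wpM2l ?(ltW (x0 l)) // ler_ln ?posrE ?divr_gt0 ?mulr_gt0 ?expR_gt0 //.
    rewrite ler_wpM2r ?invr_ge0 ?(ltW (x0 l)) // ler_wpM2r ?(ltW N0) //.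
    by rewrite ler_wpM2r ?expR_ge0 // ler_nat.
  (* [32 * 14 * 140 < 10 ^+ 5] *)
  apply: lt_le_trans cK; rewrite /L -mulrDr.
  have pK0 : 0 < psi * K by rewrite mulr_gt0.
  have -> : forall a b : RR, 32 * (14 * psi * K * (a + b)) = psi * K * (448 * (a + b)).
    by move=> a b; ring.
  have -> : forall b : RR, 10 ^+ 5 * psi * K * b = psi * K * (10 ^+ 5 * b).
    by move=> b; ring.
  rewrite ltr_pM2l //; have := xy0 l; move: S1 D0 y48.
  rewrite -/(y l).
  move: (x l * y l) (x l * ln _) D (\sum_(_ < _) _) => a1 a2 a3 a4.
  by lra.
have sub : [set t | ((c + 6 * max_norm (fun i => X i t))%:E
               <= A_m (fun i => X i t) m)%E] `<=` U.
  move=> t /= At; apply: contrapT => Ut.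
  have := @A_m_bound n N m (fun i => X i t) mN l L c L0.
  rewrite -/x => /(_ _ SL); rewrite ltNge At => H.
  suff : false by []; apply: H => k kl E q Ex qE qs.
  have [_ _] := Hev k kl; apply => //.
  have kl' : (k < l.+1)%N by [].
  by move=> evt; apply: Ut; exact: (evU (Ordinal kl')).
apply: (@le_trans _ _ (P U)).
  by apply: le_measure => //; rewrite inE //; exact: measurable_A_m_event.
apply: le_trans PU _; rewrite lee_fin sumr_const card_ord -[leLHS]mulr_natl.
rewrite ler_wpM2r ?expR_ge0 // -natr1 addrC lerD2l.
by rewrite ler_peMl // ler1n.
Qed.

End main.

Theorem mainTheorem8 :
  exists C : RR, 0 < C /\
  forall (n N : nat), (1 <= n)%N -> (1 <= N)%N ->
  forall (d : measure_display) (T : measurableType d) (P : probability T RR)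
         (X : 'I_N -> T -> n.-tuple RR) (psi : RR),
  (forall i, measurable_fun [set: T] (X i : T -> n.-tuple RB)) ->
  mutually_independent P X ->
  0 < psi ->
  (forall (i : 'I_N) (y : n.-tuple RR), enorm y = 1 ->
     (psi1_norm P (fun t => dotp (X i t) y) <= psi%:E)%E) ->
  (forall (m l : nat) (K : RR), (1 <= m <= N)%N -> l%:R <= ln (m%:R : RR) ->
     1 <= K ->
     (P [set t | ((C * psi * K *
          (m%:R / 2 ^+ l * ln (48 * expR 1 * N%:R * 2 ^+ l / m%:R)
           + Num.sqrt m%:R * ln (2 * N%:R / m%:R))
          + 6 * max_norm (fun i => X i t))%:E <= A_m (fun i => X i t) m)%E]
      <= ((1 + 2 * l%:R) *
          expR (- (2 * K * (m%:R / 2 ^+ l)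
                   * ln (12 * expR 1 * N%:R * 2 ^+ l / m%:R))))%:E)%E)
  /\
  (forall (m : nat) (K : RR), (1 <= m <= N)%N -> 1 <= K ->
     (P [set t | ((C * psi * K * Num.sqrt m%:R * ln (2 * N%:R / m%:R)
          + 6 * max_norm (fun i => X i t))%:E <= A_m (fun i => X i t) m)%E]
      <= ((1 + 2 * ln (m%:R : RR)) *
          expR (- (K * Num.sqrt m%:R * ln (2 * N%:R / m%:R))))%:E)%E).
Proof.
(* [level_tail] holds with [10 ^+ 5]; the factor 15 is [14 + 1], needed when [exists_level] bounds
   the first term by 14 times the second. *)
exists (15 * 10 ^+ 5); split; first by rewrite mulr_gt0.
move=> n N _ _ d T P X psi mX indX psi0 psi1X.
have pos (m : nat) : (1 <= m <= N)%N -> 0 < m%:R :> RR /\ 0 < N%:R :> RR.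
  by move=> /andP[m1 mN]; rewrite !ltr0n; split => //; exact: leq_trans mN.
split.
  move=> m l K mN lm K1.
  apply: (level_tail mX indX psi0 psi1X mN K1).
  have [m0 N0] := pos m mN.
  have K0 : 0 < K by apply: lt_le_trans K1.
  set Z := _ + _; have Z0 : 0 <= Z.
    have p0 : 0 < 2 ^+ l :> RR by rewrite exprn_gt0.
    have Nm : m%:R <= N%:R :> RR by rewrite ler_nat; case/andP: mN.
    have N2 : 1 <= 2 ^+ l :> RR by rewrite exprn_ege1 // ler1n.
    have e1 : 1 <= expR 1 :> RR by apply: le_trans (expR1_ge2 _); rewrite ler1n.
    rewrite addr_ge0 // mulr_ge0 ?divr_ge0 ?sqrtr_ge0 ?(ltW m0) ?(ltW p0) //.
      apply: ln_ge0; rewrite ler_pdivlMr // mul1r; apply: le_trans Nm _.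
      rewrite -[leLHS]mulr1; apply: ler_pM; rewrite ?(ltW N0) ?ler01 //.
      rewrite ler_peMl ?(ltW N0) //.
      by apply: le_trans e1 _; rewrite ler_peMl ?expR_ge0 // ler1n.
    apply: ln_ge0; rewrite ler_pdivlMr // mul1r; apply: le_trans Nm _.
    by rewrite ler_peMl ?(ltW N0) // ler1n.
  have Q0 : 0 <= 10 ^+ 5 * psi * K * Z.
    by rewrite !mulr_ge0 ?(ltW psi0) ?(ltW K0) // exprn_ge0.
  have -> : 15 * 10 ^+ 5 * psi * K * Z = 15 * (10 ^+ 5 * psi * K * Z) by rewrite !mulrA.
  by apply: ler_peMl => //; rewrite ler1n.
move=> m K mN K1; have [m0 N0] := pos m mN.
have K0 : 0 < K by apply: lt_le_trans K1.
have [l [lm Dl lD]] := @exists_level RR m N mN.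
have xE (b : RR) : b * N%:R * 2 ^+ l / m%:R = b * N%:R / (m%:R / 2 ^+ l).
  by rewrite invf_div mulrA.
apply: le_trans (level_tail mX indX psi0 psi1X mN (l := l) K1 _) _.
  rewrite xE -[X in _ <= X]mulrA.
  set D := Num.sqrt _ * _ in Dl lD *.
  have pK0 : 0 <= psi * K by rewrite mulr_ge0 // ltW.
  have -> : forall a : RR, 15 * 10 ^+ 5 * psi * K * a = psi * K * 10 ^+ 5 * (15 * a).
    by move=> a; ring.
  have -> : forall a : RR, 10 ^+ 5 * psi * K * a = psi * K * 10 ^+ 5 * a.
    by move=> a; ring.
  apply: ler_wpM2l; first by apply: mulr_ge0 => //; exact: exprn_ge0.
  move: lD; move: (m%:R / 2 ^+ l * _) D {Dl} => a b h.
  by lra.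
(* The two remaining properties of the chosen level: [l <= ln m] controls the prefactor, and
   [D <= 2 x_l y_l] the exponent. *)
rewrite lee_fin xE; apply: ler_pM; rewrite ?expR_ge0 //.
- by rewrite lerD2l ler_wpM2l.
- rewrite ler_expR lerN2 -mulrA [leRHS](_ : _ = K * (2 * (m%:R / 2 ^+ l *
      ln (12 * expR 1 * N%:R / (m%:R / 2 ^+ l))))); last by ring.
  by apply: ler_wpM2l => //; exact: ltW.
Qed.
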